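(* Let $K\subseteq G$ be a normal subgroup, where $G$ is countable and discrete. For every $c\ge 1$, the following conditions are equivalent: (i) $G/K_{[c+1]}$ has property (T); (ii) $G/[K,K]$ has property (T). If these conditions hold, every quotient of $G$ in which the image of $K$ is nilpotent has property (T). The same conclusion holds if that image is finite-by-nilpotent.
   Context: For a group $K$, the lower central series is $K_{[1]}=K$, $K_{[j+1]}=[K,K_{[j]}]$. A group $N$ is finite-by-nilpotent if it has a finite normal subgroup $F$ with $N/F$ nilpotent. A discrete group $G$ has (Kazhdan's) property (T) if every unitary representation $\pi$ of $G$ on a complex Hilbert space with almost invariant unit vectors (for every finite $C\subseteq G$ and $\varepsilon>0$ there is a unit vector $\xi$ with $\sup_{s\in C}\|\pi(s)\xi-\xi\|<\varepsilon$) has a nonzero $G$-invariant vector. *)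

(* Defs.v *)
From HB Require Import structures.
From mathcomp Require Import all_boot all_order all_algebra.
From mathcomp Require Import complex sesquilinear.
From mathcomp Require Import all_classical all_reals all_analysis.

Set Implicit Arguments.
Unset Strict Implicit.
Unset Printing Implicit Defensive.

Import Order.TTheory GRing.Theory Num.Theory Num.Def.
Import numFieldNormedType.Exports.

Local Open Scope quotient_scope.
Local Open Scope classical_set_scope.
Local Open Scope group_scope.

Record subgroup (G : groupType) := Subgroup {
  subgroup_set :> set G;
  subgroup1 : subgroup_set 1;
  subgroupM : forall x y, subgroup_set x -> subgroup_set y ->
    subgroup_set (x * y);
  subgroupV : forall x, subgroup_set x -> subgroup_set x^-1 }.

Record normalSubgroup (G : groupType) := NormalSubgroup {
  normal_subgroup :> subgroup G;
  normalJ : forall x y : G,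
    subgroup_set normal_subgroup x -> subgroup_set normal_subgroup (x ^ y) }.

Section SubgroupType.
Variables (G : groupType) (H : subgroup G).

Definition subgroup_pred : pred G := fun x => `[< subgroup_set H x >].

Record subgroup_type := SubgroupType {
  subgroup_val :> G;
  _ : subgroup_pred subgroup_val }.

HB.instance Definition _ := [isSub for subgroup_val].
HB.instance Definition _ := [Choice of subgroup_type by <:].

Lemma subgroup_pred_closed : group_closed subgroup_pred.
Proof.
split; first exact/asboolP/subgroup1.
move=> x y /asboolP Hx /asboolP Hy; apply/asboolP.
by apply: subgroupM => //; apply: subgroupV.
Qed.

HB.instance Definition _ :=
  SubChoice_isSubGroup.Build G subgroup_pred subgroup_type subgroup_pred_closed.

End SubgroupType.

Section QuotientGroup.
Variables (G : groupType) (N : normalSubgroup G).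

Definition coset_rel : rel G := fun x y => `[< subgroup_set N (x^-1 * y) >].

Lemma coset_rel_equiv : equiv_class_of coset_rel.
Proof.
split=> [x|x y|y x z].
- by apply/asboolP; rewrite mulVg; apply: subgroup1.
- by apply/asboolP/asboolP => /subgroupV; rewrite invgM invgK.
- move=> /asboolP xy /asboolP yz; apply/asboolP.
  have -> : x^-1 * z = (x^-1 * y) * (y^-1 * z) by rewrite mulgA mulgK.
  exact: subgroupM.
Qed.

Canonical coset_equiv := EquivRelPack coset_rel_equiv.

Definition quotient_group := {eq_quot coset_equiv}.

HB.instance Definition _ := Choice.on quotient_group.

Definition quotient_proj (x : G) : quotient_group := \pi_({eq_quot coset_equiv}) x.

Lemma quotient_projP x y :
  quotient_proj x = quotient_proj y <-> subgroup_set N (x^-1 * y).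
Proof.
split=> [/eqmodP/asboolP //|xy].
by apply/eqmodP/asboolP.
Qed.

Lemma quotient_proj_surj (q : quotient_group) : exists x, q = quotient_proj x.
Proof. by exists (repr q); rewrite /quotient_proj reprK. Qed.

Definition quotient_mul (p q : quotient_group) : quotient_group :=
  quotient_proj (repr p * repr q).
Definition quotient_one : quotient_group := quotient_proj 1.
Definition quotient_inv (p : quotient_group) : quotient_group :=
  quotient_proj (repr p)^-1.

Lemma repr_quotient_proj x : subgroup_set N (x^-1 * repr (quotient_proj x)).
Proof. by apply/quotient_projP; rewrite /quotient_proj reprK. Qed.

Lemma quotient_projM x y :
  quotient_mul (quotient_proj x) (quotient_proj y) = quotient_proj (x * y).
Proof.
apply/esym/quotient_projP.
have Nx := repr_quotient_proj x; have Ny := repr_quotient_proj y.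
set a := repr _ in Nx *; set b := repr _ in Ny *.
have -> : (x * y)^-1 * (a * b) = ((x^-1 * a) ^ y) * (y^-1 * b).
  by rewrite /conjg invgM !mulgA mulgK.
by apply: subgroupM => //; apply: normalJ.
Qed.

Lemma quotient_projV x : quotient_inv (quotient_proj x) = quotient_proj x^-1.
Proof.
apply/quotient_projP.
have := repr_quotient_proj x; set a := repr _ => Nx.
have -> : a^-1^-1 * x^-1 = (x^-1 * a) ^ a^-1 by rewrite /conjg mulgK.
exact: normalJ.
Qed.

Fact quotient_mulA : associative quotient_mul.
Proof.
move=> p q r.
have [x ->] := quotient_proj_surj p; have [y ->] := quotient_proj_surj q.
by have [z ->] := quotient_proj_surj r; rewrite !quotient_projM mulgA.
Qed.

Fact quotient_mul1 : left_id quotient_one quotient_mul.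
Proof.
by move=> p; have [x ->] := quotient_proj_surj p; rewrite quotient_projM mul1g.
Qed.

Fact quotient_mulr1 : right_id quotient_one quotient_mul.
Proof.
by move=> p; have [x ->] := quotient_proj_surj p; rewrite quotient_projM mulg1.
Qed.

Fact quotient_mulV : left_inverse quotient_one quotient_inv quotient_mul.
Proof.
move=> p; have [x ->] := quotient_proj_surj p.
by rewrite quotient_projV quotient_projM mulVg.
Qed.

Fact quotient_mulrV : right_inverse quotient_one quotient_inv quotient_mul.
Proof.
move=> p; have [x ->] := quotient_proj_surj p.
by rewrite quotient_projV quotient_projM mulgV.
Qed.

HB.instance Definition _ := isGroup.Build quotient_group
  quotient_mulA quotient_mul1 quotient_mulr1 quotient_mulV quotient_mulrV.

HB.instance Definition _ := isMultiplicative.Build G quotient_group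
  quotient_proj (fun x y => esym (quotient_projM x y)).
HB.instance Definition _ := Multiplicative_isUMagmaMorphism.Build G
  quotient_group quotient_proj erefl.

End QuotientGroup.

Arguments quotient_group G N : clear implicits.

Section QuotientImage.
Variables (G : groupType) (N : normalSubgroup G) (K : subgroup G).

Let im : set (quotient_group G N) := quotient_proj N @` K.

Fact quotient_image1 : im 1.
Proof. by exists 1; [exact: subgroup1 | exact: gmulf1]. Qed.

Fact quotient_imageM x y : im x -> im y -> im (x * y).
Proof.
move=> [a Ka <-] [b Kb <-]; exists (a * b); first exact: subgroupM.
exact: gmulfM.
Qed.

Fact quotient_imageV x : im x -> im x^-1.
Proof.
move=> [a Ka <-]; exists a^-1; first exact: subgroupV.
exact: gmulfV.
Qed.

Definition quotient_image : subgroup (quotient_group G N) :=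
  Subgroup quotient_image1 quotient_imageM quotient_imageV.

End QuotientImage.

Section Commutator.
Variable G : groupType.

Definition generated_set (A : set G) : set G :=
  [set x | forall H : subgroup G, A `<=` H -> subgroup_set H x].

Fact generated_set1 A : generated_set A 1.
Proof. by move=> H _; apply: subgroup1. Qed.

Fact generated_setM A x y :
  generated_set A x -> generated_set A y -> generated_set A (x * y).
Proof. by move=> Ax Ay H AH; apply: subgroupM; [exact: Ax | exact: Ay]. Qed.

Fact generated_setV A x : generated_set A x -> generated_set A x^-1.
Proof. by move=> Ax H AH; apply/subgroupV/Ax. Qed.

Definition generated (A : set G) : subgroup G :=
  Subgroup (@generated_set1 A) (@generated_setM A) (@generated_setV A).

Definition commutator_subgroup (H K : set G) : subgroup G :=
  generated [set [~ h, k] | h in H & k in K].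

Section Preimage.
Variables (H : subgroup G) (y : G).
Let P : set G := [set x | subgroup_set H (x ^ y)].
Fact conj_preimage1 : P 1. Proof. by rewrite /P /= conj1g; apply: subgroup1. Qed.
Fact conj_preimageM a b : P a -> P b -> P (a * b).
Proof. by rewrite /P /= conjMg; apply: subgroupM. Qed.
Fact conj_preimageV a : P a -> P a^-1.
Proof. by rewrite /P /= conjVg; apply: subgroupV. Qed.
Definition conj_preimage := Subgroup conj_preimage1 conj_preimageM conj_preimageV.
End Preimage.

Fact commutator_normal_subproof (H K : normalSubgroup G) (x y : G) :
  subgroup_set (commutator_subgroup H K) x ->
  subgroup_set (commutator_subgroup H K) (x ^ y).
Proof.
move=> /= Cx L HKL; apply: (Cx (conj_preimage L y)) => z [h Hh [k Kk <-]] /=.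
by rewrite conjRg; apply: HKL; exists (h ^ y);
  [exact: normalJ | exists (k ^ y) => //; exact: normalJ].
Qed.

Definition commutator (H K : normalSubgroup G) : normalSubgroup G :=
  NormalSubgroup (@commutator_normal_subproof H K).

(* The series is indexed from 1, so that [lower_central_series K 1 = K];
   index 0 is a dummy value, also equal to [K]. *)
Definition lower_central_series (K : normalSubgroup G) (j : nat) :
    normalSubgroup G :=
  iter j.-1 (commutator K) K.

Definition full_subgroup : subgroup G :=
  @Subgroup G [set: G] I (fun _ _ _ _ => I) (fun _ _ => I).

Definition full_normal : normalSubgroup G :=
  @NormalSubgroup G full_subgroup (fun _ _ _ => I).

Definition nilpotent_group : Prop :=
  exists c : nat,
    lower_central_series full_normal c.+1 = [set 1] :> set G.

End Commutator.

Arguments full_normal G : clear implicits.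
Arguments nilpotent_group G : clear implicits.

Definition finite_by_nilpotent (N : groupType) : Prop :=
  exists F : normalSubgroup N,
    finite_set F /\ nilpotent_group (quotient_group N F).

Local Open Scope ring_scope.
Local Open Scope complex_scope.

(* The inner product is linear in its first argument; norms of vectors are
   elements of [R[i]] lying on the nonnegative real axis. *)
Record hilbertSpace (R : realType) := HilbertSpace {
  hilbert_carrier :> completeNormedModType R[i];
  hilbert_dot : {dot hilbert_carrier for conjC};
  hilbert_normE : forall v : hilbert_carrier, `|v| ^+ 2 = hilbert_dot v v }.

Definition unitary_operator (R : realType) (V : hilbertSpace R)
    (U : {linear V -> V}) : Prop :=
  bijective U /\
  forall v w : V, hilbert_dot V (U v) (U w) = hilbert_dot V v w.

Record unitaryRep (R : realType) (G : groupType) (V : hilbertSpace R) :=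
  UnitaryRep {
    rep_op :> G -> {linear V -> V};
    rep_unitary : forall g : G, unitary_operator (rep_op g);
    rep_mul : forall (g h : G) (v : V),
      rep_op (g * h)%g v = rep_op g (rep_op h v) }.

(* [C] is finite, so the supremum over [C] of the displacements is below [e]
   exactly when each of them is. *)
Definition almost_invariant_vectors (R : realType) (G : groupType)
    (V : hilbertSpace R) (pi : unitaryRep G V) : Prop :=
  forall (C : set G) (e : R), finite_set C -> 0 < e ->
    exists xi : V, `|xi| = 1 /\
      forall s : G, C s -> `|pi s xi - xi| < e%:C.

Definition has_nonzero_invariant_vector (R : realType) (G : groupType)
    (V : hilbertSpace R) (pi : unitaryRep G V) : Prop :=
  exists v : V, v != 0 /\ forall g : G, pi g v = v.

Definition property_T (R : realType) (G : groupType) : Prop :=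
  forall (V : hilbertSpace R) (pi : unitaryRep G V),
    almost_invariant_vectors pi -> has_nonzero_invariant_vector pi.

(* Main.v *)
(* Write T(M) for: every representation of G trivial on M with almost invariant
   vectors has an invariant vector; this is property (T) of G/M.

   The main step is T(M) -> T(N) for M = [K,L] with L <= K and [K,M] <= N.  Let
   v be an almost invariant unit vector of a representation pi trivial on N.
   Then pi(M) is commutative and commutes with pi(K).  Over each point x of the
   spectrum of pi(M), put the rank-one operator v(x) (x) v(x)^* / |v(x)|: these
   fields form a representation of G which is trivial on M, where by T(M) an
   almost invariant vector is uniformly close to its whole orbit.  For k in K
   this says that pi(k) v is close to a multiple of v in most fibers, so that
   pi([k,l]) v is close to v, uniformly in k in K and l in L.  In the fiber over
   x the scalar pi([k,l])(x) is bimultiplicative in k and l.  For fixed l the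
   values in k form a group close to 1 for most x, so they are trivial for most
   x; the l for which this happens form a subgroup of L, and a random subgroup
   containing each element with probability at least 1 - e is all of L with
   probability at least 1 - 2e.  Hence v is close to a vector fixed by M, and
   T(M) applies to that vector.

   Direct integrals are avoided by replacing the integral over the spectrum by
   the supremum, over the finite families (a_i) in the bicommutant of pi(M) with
   sum a_i^* a_i = 1, of the corresponding sums over i; it increases when the
   family is refined.  This only yields a positive definite kernel, which is
   turned into a representation by the reproducing kernel construction.

   If the image of K is finite-by-nilpotent, some K_[d] has finite image in the
   quotient, and an almost invariant vector is nearly fixed by K_[d]. *)
Require Import Defs.
From HB Require Import structures.
From mathcomp Require Import all_boot all_order all_algebra.
From mathcomp Require Import complex sesquilinear.
From mathcomp Require Import all_classical all_reals all_analysis.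
From mathcomp Require Import cyclic separable cyclotomic.
From mathcomp Require Import ring lra.

Set Implicit Arguments.
Unset Strict Implicit.
Unset Printing Implicit Defensive.

Import Order.TTheory GRing.Theory Num.Theory Num.Def.
Import numFieldNormedType.Exports.

Local Open Scope classical_set_scope.
Local Open Scope ring_scope.
Local Open Scope complex_scope.

Local Notation Re := (@complex.Re _).
Local Notation Im := (@complex.Im _).

(** * Reproducing kernel Hilbert spaces *)

Lemma discriminant_le0 (R : realType) (a b c : R) : 0 <= c ->
  (forall t, 0 <= a + t * b *+ 2 + t ^+ 2 * c) -> b ^+ 2 <= a * c.
Proof.
rewrite le_eqVlt => /predU1P[<-|c0] H.
  rewrite mulr0; have [->|b0] := eqVneq b 0; first by rewrite expr0n.
  (* With [c = 0] the polynomial is affine; if [b] is nonzero it takes the value -1 at this [t]. *)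
  have := H (- (a + 1) / (b *+ 2)); rewrite mulr0 addr0.
  have -> : - (a + 1) / (b *+ 2) * b *+ 2 = - (a + 1) by field.
  lra.
have H1 := H (- b / c).
have : a + - b / c * b *+ 2 + (- b / c) ^+ 2 * c = a - b ^+ 2 / c.
  by field; rewrite gt_eqF.
by move=> E; rewrite E subr_ge0 ler_pdivrMr // in H1.
Qed.

(** Vanishing at 1 makes [h] periodic, so the bound on [0, 1] holds everywhere, and integer
    multiples of a nonzero value would exceed it. It gives real homogeneity of [polar] without a
    continuity argument. *)
Lemma bounded_additive (R : realType) (h : R -> R) (M : R) :
  (forall x y, h (x + y) = h x + h y) ->
  (forall x, 0 <= x <= 1 -> `|h x| <= M) -> h 1 = 0 -> forall x, h x = 0.
Proof.
move=> hD hM h1.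
have h0 : h 0 = 0 by have := hD 0 0; rewrite addr0; lra.
have hN x : h (- x) = - h x.
  by have := hD x (- x); rewrite subrr h0; lra.
have hMn x n : h (x *+ n) = h x *+ n.
  by elim: n => [|n IH]; rewrite ?mulr0n // !mulrS hD IH.
have hint (m : int) : h m%:~R = 0.
  case: m => n; first by rewrite -pmulrn hMn h1 mul0rn.
  by rewrite NegzE mulrNz hN -pmulrn hMn h1 mul0rn oppr0.
have hb x : `|h x| <= M.
  have -> : h x = h (x - (floor x)%:~R).
    by rewrite hD hN hint subr0.
  apply: hM; rewrite subr_ge0 floor_le_tmp /=.
  by rewrite lerBlDl ltW // -(intrD _ _ 1) floorD1_gt.
move=> x; apply/eqP; rewrite -normr_eq0; apply/eqP; apply/le_anti.
rewrite normr_ge0 andbT leNgt; apply/negP => hx.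
have M0 : 0 <= M by apply: le_trans (hb 0).
have := hb (x *+ (truncn (M / `|h x|)).+1).
rewrite hMn normrMn leNgt => /negP; apply.
rewrite -[X in _ < X]mulr_natr mulrC -ltr_pdivrMr //.
exact: truncnS_gt.
Qed.

(** * Jordan-von Neumann polarization of a quadratic norm *)

Section Polarization.
Variables (R : realType) (E : lmodType R[i]) (q : E -> R).
Hypothesis q_ge0 : forall u, 0 <= q u.
Hypothesis parallelogram : forall u v,
  q (u + v) + q (u - v) = q u *+ 2 + q v *+ 2.
Hypothesis qZ : forall (c : R[i]) u,
  q (c *: u) = (Re c ^+ 2 + Im c ^+ 2) * q u.

Definition polar (u v : E) : R := (q (u + v) - q (u - v)) / 4.

Lemma polar_q0 : q 0 = 0.
Proof. by rewrite -(scale0r 0) qZ expr0n /= addr0 mul0r. Qed.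

Lemma polar_qN u : q (- u) = q u.
Proof. by rewrite -scaleN1r qZ /= oppr0 expr0n /= addr0 sqrrN expr1n mul1r. Qed.

Lemma polarC u v : polar u v = polar v u.
Proof. by rewrite /polar [v + u]addrC -(polar_qN (v - u)) opprB. Qed.

Lemma polar_diag u : polar u u = q u.
Proof.
rewrite /polar subrr polar_q0 subr0 -mulr2n -scaler_nat qZ.
have -> : (2%:R : R[i]) = (2%:R : R)%:C by rewrite rmorphMn.
by rewrite /= expr0n /= addr0; field.
Qed.

(** The parallelogram law gives the midpoint identity [avg], which is applied to the halves of
    [u + v] and [u - v]. *)
Lemma polarDl u v w : polar (u + v) w = polar u w + polar v w.
Proof.
have avg a b : polar (a + b) w + polar (a - b) w = polar a w *+ 2.
  have := parallelogram (a + w) b; have := parallelogram (a - w) b.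
  rewrite /polar (addrAC a w) (addrAC a w) (addrAC a (- w)) (addrAC a (- w)).
  lra.
have dbl a : polar (a + a) w = polar a w *+ 2.
  have := avg a a; rewrite subrr.
  have -> : polar 0 w = 0 by rewrite /polar add0r sub0r polar_qN subrr mul0r.
  by rewrite addr0.
have half a : 2^-1 *: a + 2^-1 *: a = a :> E.
  by rewrite -scalerDl -mulr2n -[X in X *+ 2]mulr1 -mulrnAr mulVf ?scale1r ?pnatr_eq0.
have := avg (2^-1 *: (u + v)) (2^-1 *: (u - v)).
rewrite -dbl half -scalerDr -scalerBr.
have -> : u + v + (u - v) = u + u by rewrite addrACA subrr addr0.
have -> : u + v - (u - v) = v + v by rewrite opprB addrACA addrC addrA subrK addrC.
by rewrite !scalerDr !half => ->.
Qed.

Lemma polarNl u v : polar (- u) v = - polar u v.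
Proof.
have := polarDl u (- u) v; rewrite subrr.
have -> : polar 0 v = 0 by rewrite /polar add0r sub0r polar_qN subrr mul0r.
lra.
Qed.

Lemma polarDr u v w : polar u (v + w) = polar u v + polar u w.
Proof. by rewrite !(polarC u) polarDl. Qed.

(** The difference of the two sides is additive in [r], vanishes at 1, and is bounded on [0, 1]
    because the parallelogram law bounds both squares in [polar]. *)
Lemma polarZl (r : R) u v : polar (r%:C *: u) v = r * polar u v.
Proof.
apply/eqP; rewrite -subr_eq0; apply/eqP; move: r.
apply: (@bounded_additive _ _ ((q u + q v) / 2 + `|polar u v|)).
- by move=> x y; rewrite rmorphD scalerDl polarDl; ring.
- move=> x /andP[x0 x1]; apply: le_trans (ler_normB _ _) _; apply: lerD; last first.
    by rewrite normrM (ger0_norm x0) ler_piMl.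
  have := parallelogram (x%:C *: u) v; rewrite qZ /= expr0n /= addr0.
  have := q_ge0 (x%:C *: u + v); have := q_ge0 (x%:C *: u - v).
  rewrite /polar; set A := q (_ + _); set B := q (_ - _) => B0 A0 AB.
  have : x ^+ 2 * q u <= q u by rewrite ler_piMl // expr_le1.
  by rewrite ler_norml; lra.
- by rewrite scale1r mul1r subrr.
Qed.

Lemma polar_i u v : polar ('i *: u) ('i *: v) = polar u v.
Proof.
by rewrite /polar -scalerDr -scalerBr !qZ /= expr0n /= expr1n add0r !mul1r.
Qed.

Lemma scaleii (u : E) : 'i *: ('i *: u) = - u.
Proof. by rewrite scalerA -expr2 sqr_i scaleN1r. Qed.

Lemma polar_il u v : polar ('i *: u) v = - polar u ('i *: v).
Proof. by rewrite -(polar_i u ('i *: v)) scaleii [in RHS]polarC polarNl opprK polarC. Qed.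

Lemma polar_CS u v : polar u v ^+ 2 <= q u * q v.
Proof.
apply: discriminant_le0 => // t.
have := q_ge0 (u + t%:C *: v).
rewrite -polar_diag polarDl !polarDr !polar_diag polarZl polarC polarZl.
rewrite qZ /= expr0n /= addr0 [polar v u]polarC; lra.
Qed.

(** For a form linear in its first argument, the imaginary part of <u, v> is the real part of <u,
    iv>. *)
Definition polar_dot (u v : E) : R[i] := polar u v +i* polar u ('i *: v).

Lemma polar_dotC u v : polar_dot u v = (polar_dot v u)^*%C.
Proof.
rewrite /polar_dot /=; congr (_ +i* _); rewrite ?polar_il 1?polarC //.
by rewrite -polar_il polarC.
Qed.

Lemma polar_dotDl u v w : polar_dot (u + v) w = polar_dot u w + polar_dot v w.
Proof. by rewrite /polar_dot !polarDl. Qed.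

Lemma polar_dotZl c u v : polar_dot (c *: u) v = c * polar_dot u v.
Proof.
rewrite [c in LHS]complexE scalerDl mulrC -scalerA polar_dotDl /polar_dot.
rewrite !polarZl !polar_il !scaleii [polar u (- v)]polarC polarNl opprK.
rewrite [polar v u]polarC; case: c => a b /=; simpc.
by congr (_ +i* _); ring.
Qed.

Lemma polar_dot_diag u : polar_dot u u = (q u)%:C.
Proof.
rewrite /polar_dot polar_diag; congr (_ +i* _).
by have := polar_il u u; rewrite polarC; lra.
Qed.

Lemma polar_norm_triangle u v :
  Num.sqrt (q (u + v)) <= Num.sqrt (q u) + Num.sqrt (q v).
Proof.
rewrite -(@ler_pXn2r _ 2) ?nnegrE ?addr_ge0 ?sqrtr_ge0 //.
rewrite sqrrD !sqr_sqrtr // -polar_diag polarDl !polarDr !polar_diag.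
rewrite [polar v u]polarC -sqrtrM //.
have : polar u v <= Num.sqrt (q u * q v).
  apply: le_trans (ler_norm _) _.
  by rewrite -sqrtr_sqr ler_wsqrtr // polar_CS.
lra.
Qed.

End Polarization.

(** * Real reproducing kernel spaces, by duality with finite combinations *)

Section KernelForm.
Variables (R : realType) (X : Type).
Implicit Types (k : X -> X -> R) (s t : seq (R * X)) (f g : X -> R).

(** A list of pairs (coefficient, point) stands for a finite formal combination of points; this is
    the semi-inner product of the corresponding combinations of kernel sections. *)
Definition kform k s t : R := \sum_(p <- s) \sum_(r <- t) p.1 * r.1 * k p.2 r.2.
Definition comb_eval f s : R := \sum_(p <- s) p.1 * f p.2.
Definition comb_scale (c : R) s := [seq (c * p.1, p.2) | p <- s].

Definition psd_kernel k :=
  (forall x y, k x y = k y x) /\ (forall s, 0 <= kform k s s).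

Lemma comb_eval_cat f s t : comb_eval f (s ++ t) = comb_eval f s + comb_eval f t.
Proof. by rewrite /comb_eval big_cat. Qed.

Lemma comb_eval_scale f c s : comb_eval f (comb_scale c s) = c * comb_eval f s.
Proof.
by rewrite /comb_eval big_map mulr_sumr; apply: eq_bigr => p _; rewrite mulrA.
Qed.

Lemma comb_evalD f g s : comb_eval (f + g) s = comb_eval f s + comb_eval g s.
Proof.
by rewrite /comb_eval -big_split; apply: eq_bigr => p _ /=; rewrite -mulrDr.
Qed.

Lemma comb_evalZ (c : R) f s : comb_eval (fun x => c * f x) s = c * comb_eval f s.
Proof.
by rewrite /comb_eval mulr_sumr; apply: eq_bigr => p _ /=; rewrite mulrCA.
Qed.

Lemma kform_eval k s t : kform k s t = comb_eval (fun x => comb_eval (k x) t) s.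
Proof.
rewrite /kform /comb_eval; apply: eq_bigr => p _; rewrite mulr_sumr.
by apply: eq_bigr => r _; rewrite mulrA.
Qed.

Lemma kform_catl k s s' t : kform k (s ++ s') t = kform k s t + kform k s' t.
Proof. by rewrite /kform big_cat. Qed.

Lemma kform_scalel k c s t : kform k (comb_scale c s) t = c * kform k s t.
Proof. by rewrite !kform_eval comb_eval_scale. Qed.

Section Psd.
Variable k : X -> X -> R.
Hypothesis kP : psd_kernel k.
Local Notation N s := (kform k s s).

Lemma kformC s t : kform k s t = kform k t s.
Proof.
rewrite /kform exchange_big; apply: eq_bigr => r _; apply: eq_bigr => p _ /=.
by rewrite (proj1 kP) [p.1 * _]mulrC.
Qed.

Lemma kform_catr s t t' : kform k s (t ++ t') = kform k s t + kform k s t'.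
Proof. by rewrite !(kformC s) kform_catl. Qed.

Lemma kform_scaler c s t : kform k s (comb_scale c t) = c * kform k s t.
Proof. by rewrite !(kformC s) kform_scalel. Qed.

Lemma kform_cat s t : N (s ++ t) = N s + kform k s t *+ 2 + N t.
Proof. by rewrite kform_catl !kform_catr (kformC t s); ring. Qed.

Lemma kform_scale c s : N (comb_scale c s) = c ^+ 2 * N s.
Proof. by rewrite kform_scalel kform_scaler; ring. Qed.

Lemma kform_CS s t : kform k s t ^+ 2 <= N s * N t.
Proof.
apply: discriminant_le0 => [|c]; first exact: (proj2 kP).
have := proj2 kP (s ++ comb_scale c t).
by rewrite kform_cat kform_scale kform_scaler -mulrnAr.
Qed.

Lemma kernel_CS x y : k x y ^+ 2 <= k x x * k y y.
Proof.
have := kform_CS [:: (1, x)] [:: (1, y)].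
by rewrite /kform !big_seq1 /= !mul1r.
Qed.

(** Finiteness of the supremum [kq f], that is, membership of [f] in the reproducing kernel
    space. *)
Definition kdom f := exists M, forall s, comb_eval f s *+ 2 - N s <= M.
Definition kset f : set R := [set z | exists s, z = comb_eval f s *+ 2 - N s].
(* The squared norm of [f] in the reproducing kernel Hilbert space of [k],
   as the Legendre transform of [N]. *)
Definition kq f := sup (kset f).

Lemma kset_neq0 f : kset f !=set0.
Proof. by exists (comb_eval f [::] *+ 2 - N [::]); exists [::]. Qed.

Lemma kq_le f M : (forall s, comb_eval f s *+ 2 - N s <= M) -> kq f <= M.
Proof. by move=> H; apply: ge_sup => [|_ [s ->]] //; exact: kset_neq0. Qed.

Lemma kq_ub f s : kdom f -> comb_eval f s *+ 2 - N s <= kq f.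
Proof.
move=> [M HM]; apply: ub_le_sup; last by exists s.
by exists M => _ [t ->].
Qed.

Lemma kq_ge0 f : kdom f -> 0 <= kq f.
Proof.
move=> /kq_ub -/(_ [::]).
by rewrite /comb_eval /kform !big_nil mul0rn subr0.
Qed.

Lemma comb_eval_CS f s : kdom f -> comb_eval f s ^+ 2 <= kq f * N s.
Proof.
move=> df; apply: discriminant_le0 => [|c]; first exact: (proj2 kP).
have := kq_ub (comb_scale (- c) s) df.
by rewrite comb_eval_scale kform_scale; lra.
Qed.

(** Arithmetic-geometric mean: (2e)^2 <= 4Mn <= (M + n)^2, where e and n are the values of
    [comb_eval f] and [N] at [s]. *)
Lemma kdom_CS f M : 0 <= M -> (forall s, comb_eval f s ^+ 2 <= M * N s) ->
  (forall s, comb_eval f s *+ 2 - N s <= M).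
Proof.
move=> M0 H s; have := H s; have := proj2 kP s; move: (comb_eval f s) => e.
set n := N s => n0 h.
have : (e *+ 2) ^+ 2 <= (M + n) ^+ 2.
  have := sqr_ge0 (M - n); nra.
have : 0 <= M + n by lra.
move=> Mn h2; rewrite lerBlDr; apply: le_trans (ler_norm _) _.
by rewrite -(@ler_pXn2r _ 2) ?nnegrE // real_normK // num_real.
Qed.

Lemma kdom0 : kdom 0.
Proof.
exists 0; apply: kdom_CS => // s; rewrite mul0r /comb_eval big1 ?expr0n //.
by move=> p _; rewrite mulr0.
Qed.

Lemma kdomZ c f : kdom f -> kdom (fun x => c * f x).
Proof.
move=> df; exists (c ^+ 2 * kq f); apply: kdom_CS.
  by rewrite mulr_ge0 ?sqr_ge0 ?kq_ge0.
by move=> s; rewrite comb_evalZ exprMn -[leRHS]mulrA ler_wpM2l ?sqr_ge0 ?comb_eval_CS.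
Qed.

Lemma kdomD f g : kdom f -> kdom g -> kdom (f + g).
Proof.
move=> df dg; exists ((kq f + kq g) *+ 2); apply: kdom_CS.
  by rewrite mulrn_wge0 ?addr_ge0 ?kq_ge0.
move=> s; have := comb_eval_CS s df; have := comb_eval_CS s dg.
rewrite comb_evalD; have := sqr_ge0 (comb_eval f s - comb_eval g s); nra.
Qed.

Lemma kdomN f : kdom f -> kdom (- f).
Proof.
move=> /(kdomZ (-1)); rewrite (_ : (fun x => -1 * f x) = - f) //.
by apply/funext => x; rewrite mulN1r.
Qed.

Lemma kqZ c f : kdom f -> kq (fun x => c * f x) = c ^+ 2 * kq f.
Proof.
move=> df; have le g d : kdom g -> kq (fun x => d * g x) <= d ^+ 2 * kq g.
  move=> dg; apply: kq_le; apply: kdom_CS.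
    by rewrite mulr_ge0 ?sqr_ge0 ?kq_ge0.
  by move=> s; rewrite comb_evalZ exprMn -[leRHS]mulrA ler_wpM2l ?sqr_ge0 ?comb_eval_CS.
apply/le_anti; rewrite le //=; have [->|c0] := eqVneq c 0.
  by rewrite expr0n /= mul0r kq_ge0 //; apply: kdomZ.
have := le _ c^-1 (kdomZ c df).
rewrite (_ : (fun x => c^-1 * (c * f x)) = f); last first.
  by apply/funext => x; rewrite mulKf.
by rewrite exprVn mulrC ler_pdivlMr 1?mulrC // exprn_even_gt0.
Qed.

(** One inequality is enough: applied to [f + g] and [f - g] it gives the other. It follows by
    testing [u + v] on s + t and [u - v] on s - t, since [N] obeys the parallelogram law. *)
Lemma kq_parallelogram f g : kdom f -> kdom g ->
  kq (f + g) + kq (f - g) = kq f *+ 2 + kq g *+ 2.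
Proof.
have le u v : kdom u -> kdom v ->
    kq u *+ 2 + kq v *+ 2 <= kq (u + v) + kq (u - v).
  move=> du dv.
  have H s t : (comb_eval u s *+ 2 - N s) *+ 2 + (comb_eval v t *+ 2 - N t) *+ 2
      <= kq (u + v) + kq (u - v).
    have := kq_ub (s ++ t) (kdomD du dv).
    have := kq_ub (s ++ comb_scale (-1) t) (kdomD du (kdomN dv)).
    rewrite !comb_eval_cat !comb_eval_scale !comb_evalD.
    rewrite (_ : - v = (fun x => -1 * v x)) ?comb_evalZ; last first.
      by apply/funext => x; rewrite mulN1r.
    rewrite !kform_cat kform_scale kform_scaler; lra.
  have H1 t : kq u <= (kq (u + v) + kq (u - v) - (comb_eval v t *+ 2 - N t) *+ 2) / 2.
    by apply: kq_le => s; have := H s t; lra.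
  have : kq v <= (kq (u + v) + kq (u - v) - kq u *+ 2) / 2.
    by apply: kq_le => s; have := H1 s; lra.
  lra.
move=> df dg; apply/le_anti; rewrite le // andbT.
have := le _ _ (kdomD df dg) (kdomD df (kdomN dg)).
have -> : f + g + (f - g) = (fun x => 2 * f x).
  by apply/funext => x; rewrite !fctE; ring.
have -> : f + g - (f - g) = (fun x => 2 * g x).
  by apply/funext => x; rewrite !fctE; ring.
rewrite !kqZ //; lra.
Qed.

(** The two functions on the left are the real and imaginary parts of (a + ib)(u + iv). On the dual
    side the test pair s + it is multiplied by a - ib and divided by [r]. *)
Lemma kq_rotation a b u v : kdom u -> kdom v ->
  kq ((fun x => a * u x) + (fun x => - b * v x)) +
  kq ((fun x => a * v x) + (fun x => b * u x)) <=
  (a ^+ 2 + b ^+ 2) * (kq u + kq v).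
Proof.
move=> du dv; set r := a ^+ 2 + b ^+ 2.
have scaled f s : 0 < r -> kdom f -> comb_eval f s *+ 2 - N s / r <= r * kq f.
  move=> r0 df; have := kq_ub (comb_scale r^-1 s) df.
  rewrite comb_eval_scale kform_scale => h.
  have := ler_wpM2l (ltW r0) h; congr (_ <= _).
  by field; rewrite gt_eqF.
have H s t :
    (comb_eval ((fun x => a * u x) + (fun x => - b * v x)) s *+ 2 - N s) +
    (comb_eval ((fun x => a * v x) + (fun x => b * u x)) t *+ 2 - N t) <=
    r * (kq u + kq v).
  rewrite !comb_evalD !comb_evalZ.
  have : 0 <= r by rewrite addr_ge0 ?sqr_ge0.
  rewrite le_eqVlt => /predU1P[r0|r0].
    have := r0; rewrite /r => /esym/eqP; rewrite paddr_eq0 ?sqr_ge0 //.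
    rewrite !sqrf_eq0 => /andP[/eqP a0 /eqP b0].
    rewrite a0 b0 expr0n /= oppr0 !mul0r !addr0 mul0r.
    by have := proj2 kP s; have := proj2 kP t; lra.
  have := scaled u (comb_scale a s ++ comb_scale b t) r0 du.
  have := scaled v (comb_scale a t ++ comb_scale (- b) s) r0 dv.
  rewrite !comb_eval_cat !comb_eval_scale !kform_cat !kform_scale.
  rewrite !kform_scalel !kform_scaler (kformC t s).
  have -> : (a ^+ 2 * N s + a * (b * kform k s t) *+ 2 + b ^+ 2 * N t) / r =
    N s + N t - (a ^+ 2 * N t + a * (- b * kform k s t) *+ 2 + (- b) ^+ 2 * N s) / r.
    by rewrite /r; field; rewrite gt_eqF.
  lra.
set f := _ + (fun x => - b * _); set g := _ + (fun x => b * _).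
have H1 t : kq f <= r * (kq u + kq v) - (comb_eval g t *+ 2 - N t).
  by apply: kq_le => s; have := H s t; rewrite -/f -/g; lra.
have : kq g <= r * (kq u + kq v) - kq f.
  by apply: kq_le => s; have := H1 s; lra.
lra.
Qed.

Lemma kq_eq0 f : kdom f -> kq f = 0 -> f = 0.
Proof.
move=> df q0; apply/funext => x; have := comb_eval_CS [:: (1, x)] df.
rewrite q0 mul0r /comb_eval big_seq1 /= mul1r => h.
by apply/eqP; rewrite -sqrf_eq0 eq_le h sqr_ge0.
Qed.

(** Pairing the section with [t] gives [kform k t s], so Cauchy-Schwarz bounds the supremum by
    [N s], and [t = s] attains it. *)
Lemma kq_section s : kdom (fun x => kform k [:: (1, x)] s) /\
  kq (fun x => kform k [:: (1, x)] s) = N s.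
Proof.
set f := fun x => _.
have ev t : comb_eval f t = kform k t s.
  rewrite kform_eval; congr comb_eval; apply/funext => x.
  by rewrite /f kform_eval /comb_eval big_seq1 /= mul1r.
have H t : comb_eval f t *+ 2 - N t <= N s.
  apply: kdom_CS => [|r]; first exact: (proj2 kP).
  by rewrite ev kformC kform_CS.
have df : kdom f by exists (N s).
split=> //; apply/le_anti; rewrite kq_le //=.
by have := kq_ub s df; rewrite ev; lra.
Qed.

End Psd.
End KernelForm.

(** * The complex reproducing kernel Hilbert space and its completeness *)

Section KernelSpace.
Variables (R : realType) (X : Type) (k : X -> X -> R).

Definition kpred : pred (X -> R[i]) :=
  fun f => `[< kdom k (fun x => Re (f x)) /\ kdom k (fun x => Im (f x)) >].

Record kspace (kP : psd_kernel k) := KSpace {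
  kval :> X -> R[i];
  _ : kpred kval }.

Variable kP : psd_kernel k.

HB.instance Definition _ := [isSub for @kval kP].
HB.instance Definition _ := [Choice of kspace kP by <:].

Lemma kpred_submod_closed : submod_closed kpred.
Proof.
split.
  by apply/asboolP; split; exact: kdom0.
move=> c f g /asboolP[f1 f2] /asboolP[g1 g2]; apply/asboolP; split.
- have -> : (fun x => Re ((c *: f + g) x)) = (fun x => Re c * Re (f x)) +
      (fun x => - Im c * Im (f x)) + (fun x => Re (g x)).
    apply/funext => x; rewrite !fctE; case: c (f x) (g x) => a b [u v] [w z] /=.
    by rewrite mulNr.
  by do !apply: kdomD => //; apply: kdomZ.
- have -> : (fun x => Im ((c *: f + g) x)) = (fun x => Re c * Im (f x)) +
      (fun x => Im c * Re (f x)) + (fun x => Im (g x)).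
    by apply/funext => x; rewrite !fctE; case: c (f x) (g x) => a b [u v] [w z] /=.
  by do !apply: kdomD => //; apply: kdomZ.
Qed.

HB.instance Definition _ := GRing.SubChoice_isSubLmodule.Build R[i]
  (X -> R[i]) kpred (kspace kP) kpred_submod_closed.

Let kre (f : kspace kP) x := Re (f x).
Let kim (f : kspace kP) x := Im (f x).

Lemma kre_dom f : kdom k (kre f).
Proof. by have /asboolP[] := valP f. Qed.

Lemma kim_dom f : kdom k (kim f).
Proof. by have /asboolP[] := valP f. Qed.

Definition kspace_q (f : kspace kP) : R := kq k (kre f) + kq k (kim f).

Lemma kvalD (f g : kspace kP) x : (f + g) x = f x + g x.
Proof. by []. Qed.

Lemma kvalB (f g : kspace kP) x : (f - g) x = f x - g x.
Proof. by []. Qed.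

Lemma kvalZ (c : R[i]) (f : kspace kP) x : (c *: f) x = c * f x.
Proof. by []. Qed.

Lemma kspace_eqP (f g : kspace kP) : (forall x, f x = g x) -> f = g.
Proof. by move=> fg; apply/val_inj/funext. Qed.

Lemma kspace_q_ge0 f : 0 <= kspace_q f.
Proof.
by rewrite addr_ge0 // kq_ge0 //; [exact: kre_dom|exact: kim_dom].
Qed.

Lemma kspace_parallelogram f g : kspace_q (f + g) + kspace_q (f - g) =
  kspace_q f *+ 2 + kspace_q g *+ 2.
Proof.
have -> : kspace_q (f + g) = kq k (kre f + kre g) + kq k (kim f + kim g).
  rewrite /kspace_q; congr (kq k _ + kq k _); apply/funext => x;
  by rewrite /kre /kim kvalD !fctE; case: (f x) (g x) => [a b] [].
have -> : kspace_q (f - g) = kq k (kre f - kre g) + kq k (kim f - kim g).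
  rewrite /kspace_q; congr (kq k _ + kq k _); apply/funext => x;
  by rewrite /kre /kim kvalB !fctE; case: (f x) (g x) => [a b] [].
rewrite addrACA !kq_parallelogram ?/kspace_q; first by lra.
all: by [|exact: kre_dom|exact: kim_dom].
Qed.

Lemma kspace_qZ (c : R[i]) f :
  kspace_q (c *: f) = (Re c ^+ 2 + Im c ^+ 2) * kspace_q f.
Proof.
have le (d : R[i]) h : kspace_q (d *: h) <= (Re d ^+ 2 + Im d ^+ 2) * kspace_q h.
  rewrite {1}/kspace_q.
  have -> : kre (d *: h) = (fun x => Re d * kre h x) + (fun x => - Im d * kim h x).
    apply/funext => x; rewrite !fctE /kre /kim kvalZ.
    by case: d (h x) => a b [u v] /=; rewrite mulNr.
  have -> : kim (d *: h) = (fun x => Re d * kim h x) + (fun x => Im d * kre h x).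
    apply/funext => x; rewrite !fctE /kre /kim kvalZ.
    by case: d (h x) => a b [u v] /=.
  by apply: kq_rotation; [|exact: kre_dom|exact: kim_dom].
apply/le_anti; rewrite le /=; have [->|c0] := eqVneq c 0.
  by rewrite expr0n /= addr0 mul0r kspace_q_ge0.
(* The reverse inequality is the same bound for the inverse scalar. *)
have := le c^-1 (c *: f); rewrite scalerA mulVf // scale1r.
have n0 : 0 < Re c ^+ 2 + Im c ^+ 2.
  rewrite lt0r addr_ge0 ?sqr_ge0 // andbT paddr_eq0 ?sqr_ge0 // !sqrf_eq0.
  by move: c0; rewrite eq_complex.
have -> : Re c^-1 ^+ 2 + Im c^-1 ^+ 2 = (Re c ^+ 2 + Im c ^+ 2)^-1.
  by move: n0; case: c {c0} => a b /= n0; field; lra.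
by rewrite mulrC ler_pdivlMr 1?mulrC.
Qed.

Lemma kspace_q_eq0 f : kspace_q f = 0 -> f = 0.
Proof.
have := kq_ge0 (kre_dom f); have := kq_ge0 (kim_dom f) => i0 r0 q0.
have r1 : kq k (kre f) = 0 by move: q0; rewrite /kspace_q; lra.
have i1 : kq k (kim f) = 0 by move: q0; rewrite /kspace_q; lra.
apply: kspace_eqP => x; apply/eqP; rewrite eq_complex; apply/andP; split; apply/eqP.
  by have := kq_eq0 kP (kre_dom f) r1; move/(congr1 (fun h => h x)).
by have := kq_eq0 kP (kim_dom f) i1; move/(congr1 (fun h => h x)).
Qed.

Definition kspace_norm (f : kspace kP) : R[i] := (Num.sqrt (kspace_q f))%:C.

Lemma kspace_normD f g : kspace_norm (f + g) <= kspace_norm f + kspace_norm g.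
Proof.
rewrite /kspace_norm -rmorphD lecR.
exact: (polar_norm_triangle kspace_q_ge0 kspace_parallelogram kspace_qZ).
Qed.

Lemma kspace_normZ (l : R[i]) f : kspace_norm (l *: f) = `|l| * kspace_norm f.
Proof.
rewrite /kspace_norm kspace_qZ sqrtrM ?addr_ge0 ?sqr_ge0 // rmorphM.
by case: l.
Qed.

Lemma kspace_norm_eq0 f : kspace_norm f = 0 -> f = 0.
Proof.
case=> /eqP; rewrite sqrtr_eq0 => q0; apply: kspace_q_eq0.
by apply/le_anti; rewrite q0 kspace_q_ge0.
Qed.

HB.instance Definition _ := Lmodule_isNormed.Build R[i] (kspace kP)
  kspace_normD kspace_normZ kspace_norm_eq0.

Lemma kspace_eval_CS (f : kspace kP) x :
  Re (f x) ^+ 2 + Im (f x) ^+ 2 <= kspace_q f * k x x.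
Proof.
have := comb_eval_CS kP [:: (1, x)] (kre_dom f).
have := comb_eval_CS kP [:: (1, x)] (kim_dom f).
rewrite /comb_eval /kform !big_seq1 /= !mul1r /kspace_q /kre /kim; lra.
Qed.

Lemma comb_eval_cvg (F : set_system (kspace kP)) (h : kspace kP -> X -> R)
    (l : X -> R) s : Filter F -> (forall x, h f x @[f --> F] --> l x) ->
  comb_eval (h f) s @[f --> F] --> comb_eval l s.
Proof.
move=> FF hl; rewrite /comb_eval; elim: s => [|p s IH].
  rewrite big_nil; under eq_fun do rewrite big_nil; exact: cvg_cst.
rewrite big_cons; under eq_fun do rewrite big_cons.
by apply: cvgD => //; apply: cvgMr.
Qed.

Lemma kspace_cauchyP (F : set_system (kspace kP)) : ProperFilter F ->
  cauchy F -> forall e : R, 0 < e ->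
  exists A, F A /\ forall f g, A f -> A g -> kspace_q (f - g) <= e.
Proof.
move=> FF /cauchy_ballP cF e e0.
have se0 : 0 < Num.sqrt e by rewrite sqrtr_gt0.
have se1 : 0 < (Num.sqrt e)%:C :> R[i] by rewrite ltcR.
have [[A B] /= [FA FB] AB] := cF _ se1.
exists (A `&` B); split; first exact: filterI.
move=> f g [Af _] [_ Bg]; have := AB (f, g) (conj Af Bg).
rewrite /ball /= /ball_ /= => h.
have : kspace_norm (f - g) < (Num.sqrt e)%:C by apply: h.
by rewrite ltcR ltr_sqrt // => /ltW.
Qed.

(** Evaluations are continuous, so a Cauchy filter converges pointwise. The squared norm is a
    supremum of expressions in finitely many values, hence the Cauchy estimates survive the
    pointwise limit. *)
Lemma kspace_complete (F : set_system (kspace kP)) : ProperFilter F ->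
  cauchy F -> cvg F.
Proof.
move=> FF cF; have H := kspace_cauchyP FF cF.
have cvR (h : kspace kP -> X -> R) x :
    (forall f g, (h f x - h g x) ^+ 2 <= kspace_q (f - g) * k x x) ->
    cvg (h f x @[f --> F]).
  move=> hq; apply: cauchy_cvg; apply/cauchy_ballP => e e0.
  have k0 : 0 <= k x x.
    by have := proj2 kP [:: (1, x)]; rewrite /kform !big_seq1 /= !mul1r.
  have d0 : 0 < e ^+ 2 / (k x x + 1) by rewrite divr_gt0 ?exprn_gt0 //; lra.
  have [A [FA hA]] := H _ d0.
  exists ((h^~ x) @` A, (h^~ x) @` A) => /=.
    have FhA : F (h^~ x @^-1` (h^~ x @` A)) by apply: filterS FA => f Af; exists f.
    by split; exact: FhA.
  move=> [_ _] /= [[f Af <-] [g Ag <-]]; rewrite /ball /=.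
  rewrite -(@ltr_pXn2r _ 2) ?nnegrE ?normr_ge0 ?(ltW e0) // real_normK ?num_real //.
  apply: le_lt_trans (hq f g) _.
  apply: le_lt_trans (ler_wpM2r k0 (hA _ _ Af Ag)) _.
  by rewrite mulrAC ltr_pdivrMr ?ltr_pM2l ?exprn_gt0 //; lra.
have c1 x : cvg (kre f x @[f --> F]).
  apply: cvR => f g; have := kspace_eval_CS (f - g) x; rewrite kvalB /kre.
  case: (f x) (g x) => [a b] [c d] /=.
  by have := sqr_ge0 (b - d); lra.
have c2 x : cvg (kim f x @[f --> F]).
  apply: cvR => f g; have := kspace_eval_CS (f - g) x; rewrite kvalB /kim.
  case: (f x) (g x) => [a b] [c d] /=.
  by have := sqr_ge0 (a - c); lra.
pose l1 x := lim (kre f x @[f --> F]); pose l2 x := lim (kim f x @[f --> F]).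
(* The test combinations of the real and imaginary parts stay independent: an empty one isolates the
   other part, and the two suprema are taken one after the other. *)
have key e A g : F A -> (forall f g, A f -> A g -> kspace_q (f - g) <= e) -> A g ->
    forall s t, (comb_eval (l1 - kre g) s *+ 2 - kform k s s) +
      (comb_eval (l2 - kim g) t *+ 2 - kform k t t) <= e.
  move=> FA hA Ag s t.
  have evB u v w : comb_eval (u - v) w = comb_eval u w - comb_eval v w.
    rewrite comb_evalD (_ : - v = (fun x => -1 * v x)) ?comb_evalZ ?mulN1r //.
    by apply/funext => x; rewrite mulN1r.
  have cv : (comb_eval (kre f) s - comb_eval (kre g) s) *+ 2 - kform k s s +
     ((comb_eval (kim f) t - comb_eval (kim g) t) *+ 2 - kform k t t) @[f --> F] -->
     (comb_eval l1 s - comb_eval (kre g) s) *+ 2 - kform k s s +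
     ((comb_eval l2 t - comb_eval (kim g) t) *+ 2 - kform k t t).
    apply: cvgD; apply: cvgB; try exact: cvg_cst; apply: cvgMn; apply: cvgB;
      try exact: cvg_cst; apply: comb_eval_cvg => x; [exact: c1|exact: c2].
  rewrite !evB; apply: (closed_cvg (fun z => z <= e)) cv => //.
  apply: filterS FA => f Af; apply: le_trans (hA _ _ Af Ag).
  have := kq_ub s (kre_dom (f - g)); have := kq_ub t (kim_dom (f - g)).
  have -> : kre (f - g) = kre f - kre g.
    by apply/funext => x; rewrite !fctE /kre kvalB; case: (f x) (g x) => a b [].
  have -> : kim (f - g) = kim f - kim g.
    by apply/funext => x; rewrite !fctE /kim kvalB; case: (f x) (g x) => a b [].
  rewrite !evB /kspace_q.
  have -> : kre (f - g) = kre f - kre g.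
    by apply/funext => x; rewrite !fctE /kre kvalB; case: (f x) (g x) => a b [].
  have -> : kim (f - g) = kim f - kim g.
    by apply/funext => x; rewrite !fctE /kim kvalB; case: (f x) (g x) => a b [].
  lra.
have nil0 u : comb_eval u [::] *+ 2 - kform k [::] [::] = 0.
  by rewrite /comb_eval /kform !big_nil mul0rn subr0.
have lP : kpred (fun x => l1 x +i* l2 x).
  have [A [FA hA]] := H 1 ltr01; have [g Ag] := filter_ex FA.
  have K := key _ _ _ FA hA Ag.
  apply/asboolP; split=> /=.
  - rewrite (_ : (fun x => l1 x) = (l1 - kre g) + kre g); last first.
      by apply/funext => x; rewrite !fctE subrK.
    apply: kdomD => //; last exact: kre_dom.
    by exists 1 => s; have := K s [::]; rewrite nil0 addr0.
  - rewrite (_ : (fun x => l2 x) = (l2 - kim g) + kim g); last first.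
      by apply/funext => x; rewrite !fctE subrK.
    apply: kdomD => //; last exact: kim_dom.
    by exists 1 => s; have := K [::] s; rewrite nil0 add0r.
pose l : kspace kP := KSpace kP lP.
apply/cvg_ex; exists l; apply/cvgrPdist_le => e; rewrite ltcE /= => /andP[/eqP ei er].
have [A [FA hA]] := H _ (exprn_gt0 2 er).
apply: (filterS _ (FA)) => g Ag; rewrite /Num.norm /= /kspace_norm.
rewrite lecE /= eq_sym -ei eqxx /=.
rewrite -[leRHS](ger0_norm (ltW er)) -sqrtr_sqr ler_wsqrtr //.
have K := key _ _ _ (FA) hA Ag.
have -> : kspace_q (l - g) = kq k (l1 - kre g) + kq k (l2 - kim g).
  rewrite /kspace_q; congr (kq k _ + kq k _); apply/funext => x;
  by rewrite /kre /kim kvalB !fctE /=; case: (g x).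
have K1 t : kq k (l1 - kre g) <= Re e ^+ 2 - (comb_eval (l2 - kim g) t *+ 2 - kform k t t).
  by apply: kq_le => s; have := K s t; lra.
have : kq k (l2 - kim g) <= Re e ^+ 2 - kq k (l1 - kre g).
  by apply: kq_le => t; have := K1 t; lra.
lra.
Qed.

HB.instance Definition _ := Uniform_isComplete.Build (kspace kP) kspace_complete.

Definition kspace_dot : kspace kP -> kspace kP -> R[i] := polar_dot kspace_q.

Lemma kspace_dotC f g : kspace_dot f g = (kspace_dot g f)^*.
Proof.
exact: (polar_dotC kspace_parallelogram kspace_qZ).
Qed.

Lemma kspace_dot_diag f : kspace_dot f f = (kspace_q f)%:C.
Proof.
exact: (polar_dot_diag kspace_parallelogram kspace_qZ).
Qed.

Lemma kspace_dot_bilinear :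
  bilinear_for *%R (Num.conj \; *%R) kspace_dot.
Proof.
have Dl := polar_dotDl kspace_parallelogram kspace_qZ.
have Zl := polar_dotZl kspace_q_ge0 kspace_parallelogram kspace_qZ.
split=> u c v w; first by rewrite /kspace_dot Dl Zl.
rewrite (kspace_dotC u (_ + w)) (kspace_dotC u v) (kspace_dotC u w).
by rewrite /kspace_dot Dl Zl rmorphD rmorphM.
Qed.

HB.instance Definition _ := bilinear_isBilinear.Build R[i] (kspace kP)
  (kspace kP) R[i] *%R (Num.conj \; *%R) kspace_dot kspace_dot_bilinear.

HB.instance Definition _ := isHermitianSesquilinear.Build R[i] (kspace kP)
  false Num.conj kspace_dot (fun f g => etrans (kspace_dotC f g) (esym (mul1r _))).

Lemma kspace_dot_gt0 f : f != 0 -> 0 < kspace_dot f f.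
Proof.
move=> f0; rewrite kspace_dot_diag ltcR lt0r kspace_q_ge0 andbT.
by apply: contraNneq f0 => /kspace_q_eq0 ->.
Qed.

HB.instance Definition _ := isDotProduct.Build R[i] (kspace kP) kspace_dot
  kspace_dot_gt0.

Lemma kspace_normE f : `|f| ^+ 2 = kspace_dot f f.
Proof.
rewrite kspace_dot_diag /Num.norm /= /kspace_norm -rmorphXn /=.
by rewrite sqr_sqrtr ?kspace_q_ge0.
Qed.

Definition kspace_hilbert : hilbertSpace R :=
  @HilbertSpace R (kspace kP) kspace_dot kspace_normE.

End KernelSpace.

(** * Property (T) and uniform convergence of positive definite kernels *)

Section KernelSum.
Variables (R : realType).

(** This block-diagonal kernel yields the orthogonal direct sum of the spaces of the [k i]; grouping
    a combination by its index splits the form into blocks. *)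
Lemma psd_kernel_sum (I Y : eqType) (k : I -> Y -> Y -> R) :
  (forall i, psd_kernel (k i)) ->
  psd_kernel (fun p r : I * Y => (p.1 == r.1)%:R * k p.1 p.2 r.2).
Proof.
move=> kP; split=> [[i x] [j y]|s] /=.
  rewrite [j == i]eq_sym; case: eqP => [->|]; last by rewrite !mul0r.
  by rewrite (proj1 (kP j)).
pose part i := [seq (p.1, p.2.2) | p <- s & p.2.1 == i].
have -> : kform (fun p r : I * Y => (p.1 == r.1)%:R * k p.1 p.2 r.2) s s =
   \sum_(i <- undup [seq p.2.1 | p <- s]) kform (k i) (part i) (part i).
  rewrite /kform; under [RHS]eq_bigr => i _.
    rewrite big_map big_filter big_mkcond.
    under eq_bigr => p _.
      rewrite big_map big_filter big_mkcond.
      over.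
    over.
  rewrite [RHS]exchange_big /=; apply: eq_big_seq => p ps /=.
  rewrite [RHS](bigD1_seq p.2.1) ?undup_uniq //=; last first.
    by rewrite mem_undup; apply/mapP; exists p.
  rewrite eqxx [X in _ + X]big1 ?addr0 => [|i ip]; last by rewrite eq_sym (negPf ip).
  apply: eq_bigr => r _; rewrite eq_sym; case: eqP => _; last by rewrite mul0r mulr0.
  by rewrite mul1r.
by apply: sumr_ge0 => i _; exact: (proj2 (kP i)).
Qed.

Variables (X : Type) (k : X -> X -> R) (x0 : X).
Hypothesis kP : psd_kernel k.

Definition weight (s : seq (R * X)) : R := \sum_(p <- s) p.1.

(** The squared distance from 0 to the affine span of the kernel sections. For a
    translation-invariant kernel the nearest point of the closed span is the projection of a section
    to the invariant vectors, so subtracting this constant from the kernel removes the invariant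
    part. *)
Definition affine_inf : R := inf [set kform k s s | s in [set s | weight s = 1]].

Lemma affine_inf_le s : weight s = 1 -> affine_inf <= kform k s s.
Proof.
move=> s1; apply: ge_inf; last by exists s.
by exists 0 => _ [t _ <-]; exact: (proj2 kP).
Qed.

Lemma affine_inf_adherent e : 0 < e ->
  exists s, weight s = 1 /\ kform k s s < affine_inf + e.
Proof.
move=> e0; have [|_ [s s1 <-] h] := @inf_adherent _
    [set kform k s s | s in [set s | weight s = 1]] _ e0.
  split; last by exists 0 => _ [t _ <-]; exact: (proj2 kP).
  by exists (kform k [:: (1, x0)] [:: (1, x0)]); exists [:: (1, x0)];
    rewrite //= /weight big_seq1.
by exists s.
Qed.

Lemma kform_shift (c : R) s :
  kform (fun x y => k x y - c) s s = kform k s s - c * weight s ^+ 2.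
Proof.
have -> : c * weight s ^+ 2 = \sum_(p <- s) \sum_(r <- s) p.1 * r.1 * c.
  rewrite /weight expr2 mulrA mulrC mulr_suml; apply: eq_bigr => p _.
  by rewrite mulr_sumr mulr_sumr; apply: eq_bigr => r _; ring.
rewrite -sumrB; apply: eq_bigr => p _; rewrite -sumrB.
by apply: eq_bigr => r _; rewrite mulrBr.
Qed.

(** A combination of weight 0 does not see the constant; any other is rescaled to weight 1. *)
Lemma psd_kernel_shift : psd_kernel (fun x y => k x y - affine_inf).
Proof.
split=> [x y|s]; first by rewrite (proj1 kP).
rewrite kform_shift; have [->|w0] := eqVneq (weight s) 0.
  by rewrite expr0n mulr0 subr0 (proj2 kP).
have w1 : weight (comb_scale (weight s)^-1 s) = 1.
  by rewrite /weight /comb_scale big_map -mulr_sumr mulVf.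
have := affine_inf_le w1; rewrite kform_scale // exprVn mulrC ler_pdivlMr.
  by rewrite subr_ge0.
by rewrite exprn_even_gt0.
Qed.

End KernelSum.

Section Translation.
Variables (R : realType) (X : Type) (k : X -> X -> R) (kP : psd_kernel k).
Variable tau : X -> X.
Hypothesis tau_inv : forall x y, k (tau x) (tau y) = k x y.

(** Test combinations pushed forward by [tau] keep their form. For group translations the inverse
    then gives equality. *)
Lemma kq_comp f : kdom k f ->
  kdom k (f \o tau) /\ kq k (f \o tau) <= kq k f.
Proof.
move=> df.
have H s : comb_eval (f \o tau) s *+ 2 - kform k s s <= kq k f.
  have := kq_ub [seq (p.1, tau p.2) | p <- s] df.
  have -> : comb_eval f [seq (p.1, tau p.2) | p <- s] = comb_eval (f \o tau) s.
    by rewrite /comb_eval big_map.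
  congr (_ - _ <= _); rewrite /kform big_map; apply: eq_bigr => p _.
  by rewrite big_map; apply: eq_bigr => r _ /=; rewrite tau_inv.
by split; [exists (kq k f)|exact: kq_le].
Qed.

Lemma ktranslate_subproof (f : kspace kP) : kpred k (f \o tau).
Proof.
apply/asboolP; split.
  exact: (proj1 (kq_comp (kre_dom f))).
exact: (proj1 (kq_comp (kim_dom f))).
Qed.

Definition ktranslate (f : kspace kP) : kspace kP :=
  KSpace kP (ktranslate_subproof f).

Lemma ktranslate_linear : linear ktranslate.
Proof. by move=> c f g; apply: kspace_eqP. Qed.

HB.instance Definition _ := GRing.isLinear.Build R[i] (kspace kP) (kspace kP) _
  ktranslate ktranslate_linear.

Lemma ktranslate_q f : kspace_q (ktranslate f) <= kspace_q f.
Proof.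
apply: lerD.
  exact: (proj2 (kq_comp (kre_dom f))).
exact: (proj2 (kq_comp (kim_dom f))).
Qed.

End Translation.

Section KernelSections.
Variables (R : realType) (X : Type) (k : X -> X -> R) (kP : psd_kernel k).

Lemma kq0 : kq k (fun=> 0) = 0.
Proof.
have := kqZ kP 0 (kdom0 kP); rewrite expr0n /= mul0r => {2}<-.
by congr (kq k _); apply/funext => x; rewrite mul0r.
Qed.

Lemma ksection_subproof s : kpred k (fun x => (kform k [:: (1, x)] s)%:C).
Proof.
apply/asboolP; split; first exact: (proj1 (kq_section kP _)).
exact: kdom0.
Qed.

Definition ksection s : kspace kP := KSpace kP (ksection_subproof s).

Lemma ksectionE s x : ksection s x = (comb_eval (k x) s)%:C.
Proof. by rewrite /= kform_eval /comb_eval big_seq1 mul1r. Qed.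

Lemma ksection_q s : kspace_q (ksection s) = kform k s s.
Proof. by rewrite /kspace_q (proj2 (kq_section kP s)) kq0 addr0. Qed.

End KernelSections.

(** * Uniform estimates for positive definite kernels under property (T) *)

Section UniformKernels.
Variables (R : realType) (G : groupType).

(** The condition T(M), stated on [G] so that different subgroups are compared without changing the
    group. *)
Definition kazhdan_mod (M : set G) := forall (V : hilbertSpace R) (pi : unitaryRep G V),
  (forall m, M m -> forall v, pi m v = v) -> almost_invariant_vectors pi ->
  has_nonzero_invariant_vector pi.

Definition invariant_kernel (k : G -> G -> R) :=
  forall s g h, k (s * g)%g (s * h)%g = k g h.

(** By invariance [k m m = 1], so the last clause says that the sections at [m] and at 1 coincide:
    the cyclic unit vector is fixed by [M]. *)
Definition unit_kernel (M : set G) (k : G -> G -> R) :=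
  [/\ psd_kernel k, invariant_kernel k, k 1%g 1%g = 1 &
      forall m, M m -> k m 1%g = 1].

(** * Direct sum of non-uniform kernels with the invariant vectors removed *)

Section NonUniform.
Variables (M : set G) (d : R) (K : seq G * nat -> G -> G -> R).
Hypothesis d_gt0 : 0 < d.
Hypothesis MV : forall m, M m -> M (m^-1)%g.
Hypothesis MJ : forall m g, M m -> M (m ^ g)%g.
Hypothesis KM : forall i, unit_kernel M (K i).
Hypothesis Knear : forall i s, s \in i.1 -> 1 - K i s 1%g < i.2.+1%:R^-1.
Hypothesis Kfar : forall i, exists g, d < 1 - K i g 1%g.

Let c i := affine_inf (K i).
Let psi i g h := K i g h - c i.
Let kX (p r : (seq G * nat) * G) := (p.1 == r.1)%:R * psi p.1 p.2 r.2.

Let K_diag i g : K i g g = 1.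
Proof. by have [_ KI K1 _] := KM i; rewrite -K1 -(KI g 1%g 1%g) mulg1. Qed.

Let psi_psd i : psd_kernel (psi i).
Proof. by have [KP _ _ _] := KM i; exact: (psd_kernel_shift KP). Qed.

Let kX_psd : psd_kernel kX.
Proof. exact: (psd_kernel_sum psi_psd). Qed.

Let tau (s : G) (p : (seq G * nat) * G) := (p.1, (s^-1 * p.2)%g).

Let kX_tau s x y : kX (tau s x) (tau s y) = kX x y.
Proof. by have [_ KI _ _] := KM x.1; rewrite /kX /tau /= /psi KI. Qed.

Let V := kspace_hilbert kX_psd.

Let op (s : G) : {linear V -> V} := ktranslate (kP := kX_psd) (kX_tau s).

Let opM s t (v : V) : op (s * t)%g v = op s (op t v).
Proof.
apply: kspace_eqP => -[i g] /=; rewrite /tau /=.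
by rewrite invgM mulgA.
Qed.

Let op1 (v : V) : op 1%g v = v.
Proof. by apply: kspace_eqP => -[i g] /=; rewrite /tau /= invg1 mul1g. Qed.

Let op_q s (v : V) : kspace_q (op s v) = kspace_q v.
Proof.
apply/le_anti; rewrite ktranslate_q /=.
by rewrite -{1}[v]op1 -(mulVg s) opM ktranslate_q.
Qed.

Let op_unitary s : unitary_operator (op s).
Proof.
split; first by exists (op s^-1%g) => v; rewrite -opM ?mulVg ?mulgV op1.
by move=> v w; rewrite /= /kspace_dot /polar_dot /polar -!linearZ
  -!linearD -!linearB !op_q.
Qed.

Let pi : unitaryRep G V := UnitaryRep op_unitary opM.

Let eval0 (f : V) s : kform kX s s = 0 ->
  comb_eval (fun x => Re ((f : kspace _) x)) s = 0 /\
  comb_eval (fun x => Im ((f : kspace _) x)) s = 0.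
Proof.
move=> s0; have := comb_eval_CS kX_psd s (kre_dom f).
have := comb_eval_CS kX_psd s (kim_dom f).
rewrite s0 !mulr0 => h1 h2.
by split; apply/eqP; rewrite -sqrf_eq0 eq_le sqr_ge0 andbT.
Qed.

Let pi_M m : M m -> forall v, pi m v = v.
Proof.
move=> Mm v; apply: kspace_eqP => -[i g].
have [_ KI K1 KM1] := KM i.
(* The sections at [m^-1 g] and [g] differ by a null vector, so every function in the space agrees
   at these points; stability of [M] under conjugation is used here. *)
have N0 : kform kX [:: (1, (i, (m^-1 * g)%g)); (-1, (i, g))]
                   [:: (1, (i, (m^-1 * g)%g)); (-1, (i, g))] = 0.
  rewrite /kform !big_cons !big_nil /kX /= eqxx /psi !K_diag.
  have -> : K i (m^-1 * g)%g g = 1.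
    rewrite -(KI g^-1%g) mulVg; apply: KM1.
    by rewrite -conjgE; apply: MJ; apply: MV.
  have -> : K i g (m^-1 * g)%g = 1.
    have := KI (g^-1 * m)%g g (m^-1 * g)%g; rewrite mulgA mulgK mulVg => <-.
    by apply: KM1; rewrite -mulgA -conjgE; apply: MJ.
  by ring.
have [] := eval0 v N0; rewrite /comb_eval !big_cons !big_nil /=.
rewrite !mul1r !addr0 !mulN1r => /subr0_eq h1 /subr0_eq h2.
by apply/eqP; rewrite eq_complex; apply/andP; split; apply/eqP.
Qed.

(** Cauchy-Schwarz for [psi i] puts [K i g 1] within 1 - c of c, hence within 2(1 - c) of 1, while
    [Kfar] supplies a value farther than [d] away. So the base vectors stay away from 0. *)
Let psi1 i : d / 2 <= 1 - c i.
Proof.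
have [g hg] := Kfar i; have := kernel_CS (psi_psd i) g 1%g.
rewrite /psi !K_diag -expr2; set b := 1 - c i => h.
have b0 : 0 <= b.
  by have := proj2 (psi_psd i) [:: (1, 1%g)];
    rewrite /kform !big_seq1 /= !mul1r /psi K_diag.
have : `|K i g 1%g - c i| <= b.
  by rewrite -(@ler_pXn2r _ 2) ?nnegrE // real_normK ?num_real.
by rewrite ler_norml /b => /andP[h1 h2]; lra.
Qed.

Let base i : V := ksection kX_psd [:: (1, (i, 1%g))].

Let base_q i : kspace_q (base i) = 1 - c i.
Proof.
by rewrite ksection_q /kform !big_seq1 /kX /= eqxx !mul1r /psi K_diag.
Qed.

Let base_disp i s : kspace_q (op s (base i) - base i) = (1 - K i s 1%g) *+ 2.
Proof.
have -> : op s (base i) - base i =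
    ksection kX_psd [:: (1, (i, s)); (-1, (i, 1%g))].
  apply: kspace_eqP => x; rewrite kvalB ksectionE.
  have -> : (op s (base i) : kspace _) x = ksection kX_psd [:: (1, (i, 1%g))] (tau s x).
    by [].
  rewrite !ksectionE.
  rewrite /comb_eval !big_cons !big_nil /= !mul1r !addr0 mulN1r.
  have -> : kX (tau s x) (i, 1%g) = kX x (i, s).
    by rewrite -[RHS](kX_tau s) /tau /= mulVg.
  by rewrite rmorphB.
rewrite ksection_q /kform !big_cons !big_nil /kX /= eqxx /psi !K_diag.
have -> : K i 1%g s = K i s 1%g by have [[KC _] _ _ _] := KM i; rewrite KC.
by rewrite (_ : true%:R = 1 :> R) //; ring.
Qed.

(** An invariant function is constant on each copy of [G]. This constant is its pairing with every
    combination of weight 1, and such combinations have arbitrarily small norm for the shifted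
    kernel. *)
Let no_invariant (f : V) : (forall s, op s f = f) -> f = 0.
Proof.
move=> finv; apply: kspace_eqP => -[i g].
have fc h : (f : kspace _) (i, h) = (f : kspace _) (i, 1%g).
  by rewrite -[in LHS](finv h) /= /tau /= mulVg.
have small (u : kspace kX_psd -> _ -> R) : (forall h, u f (i, h) = u f (i, 1%g)) ->
    kdom kX (u f) -> u f (i, 1%g) = 0.
  move=> uc du; apply/eqP; rewrite -sqrf_eq0; apply/eqP/le_anti; rewrite sqr_ge0 andbT.
  apply/ler_addgt0Pr => e e0; rewrite add0r.
  have q0 := kq_ge0 du.
  have d0 : 0 < e / (kq kX (u f) + 1) by rewrite divr_gt0 //; lra.
  have [KP _ _ _] := KM i.
  have [s [s1 hs]] := affine_inf_adherent 1%g KP d0.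
  have := comb_eval_CS kX_psd [seq (p.1, (i, p.2)) | p <- s] du.
  have -> : comb_eval (u f) [seq (p.1, (i, p.2)) | p <- s] = u f (i, 1%g).
    rewrite /comb_eval big_map -[RHS]mul1r -s1 mulr_suml.
    by apply: eq_bigr => p _; rewrite /= uc.
  have -> : kform kX [seq (p.1, (i, p.2)) | p <- s] [seq (p.1, (i, p.2)) | p <- s] =
      kform (psi i) s s.
    rewrite /kform big_map; apply: eq_bigr => p _; rewrite big_map.
    by apply: eq_bigr => r _; rewrite /kX /= eqxx mul1r.
  rewrite kform_shift s1 expr1n mulr1 => h; apply: le_trans h _.
  rewrite -[leRHS](divfK (x := kq kX (u f) + 1)); last by rewrite gt_eqF //; lra.
  rewrite mulrC; apply: ler_pM => //; try lra.
  by have := affine_inf_le KP s1; rewrite subr_ge0.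
rewrite fc; apply/eqP; rewrite eq_complex; apply/andP; split; apply/eqP.
  by apply: (small (fun f x => Re (f x))) => [h|]; [rewrite fc|exact: kre_dom].
by apply: (small (fun f x => Im (f x))) => [h|]; [rewrite fc|exact: kim_dom].
Qed.

Let almost : almost_invariant_vectors pi.
Proof.
move=> C e fC e0; have /finite_seqP[S CS] := fC.
(* This makes 1/(n + 1) less than d e^2 / 4. The squared displacement is 2(1 - K) and the squared
   norm of the base vector is at least d / 2, so the normalized displacement is below [e]. *)
pose n := truncn (4 / d / e ^+ 2).
pose i := (S, n) : seq G * nat.
have b0 : 0 < 1 - c i by apply: lt_le_trans (psi1 i); rewrite divr_gt0.
pose r := (Num.sqrt (1 - c i))^-1.
exists (r%:C *: base i); split.
  rewrite normrZ ger0_norm ?ler0c ?invr_ge0 ?sqrtr_ge0 //.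
  rewrite /Num.norm /= /kspace_norm base_q -rmorphM /r mulVf //.
  by rewrite gt_eqF // sqrtr_gt0.
move=> s; rewrite CS /= => sS; rewrite linearZ -scalerBr /=.
rewrite /Num.norm /= /kspace_norm kspace_qZ /= expr0n /= addr0 base_disp ltcR.
rewrite -[ltRHS](ger0_norm (ltW e0)) -sqrtr_sqr ltr_sqrt ?exprn_gt0 //.
rewrite /r exprVn sqr_sqrtr ?(ltW b0) // mulrC ltr_pdivrMr //.
have h1 := Knear (i := i) sS; have h2 := psi1 i.
have h3 : n.+1%:R^-1 < d / 4 * e ^+ 2.
  have : 4 / d / e ^+ 2 < n.+1%:R by exact: truncnS_gt.
  rewrite -ltf_pV2 ?posrE ?ltr0n ?divr_gt0 ?exprn_gt0 //.
  by congr (_ < _); field; rewrite !gt_eqF.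
have h4 : 1 - K i s 1%g < d / 4 * e ^+ 2 := lt_trans h1 h3.
have := ler_wpM2l (sqr_ge0 e) h2; lra.
Qed.

Lemma kernels_not_uniform : ~ kazhdan_mod M.
Proof.
move=> /(_ V pi pi_M almost)[v [v0 hv]].
by move/eqP: v0; apply; exact: no_invariant.
Qed.

End NonUniform.

(** Failure for every finite list and every precision 1/(n + 1) would provide, by choice, the
    kernels excluded by [kernels_not_uniform]. *)
Theorem kernels_uniform (M : set G) (d : R) : 0 < d ->
  (forall m, M m -> M (m^-1)%g) -> (forall m g, M m -> M (m ^ g)%g) ->
  kazhdan_mod M -> exists (C : seq G) (e : R), 0 < e /\
    forall k, unit_kernel M k -> (forall s, s \in C -> 1 - k s 1%g < e) ->
    forall g, 1 - k g 1%g <= d.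
Proof.
move=> d0 MV MJ TM; apply: contrapT => H.
have /choice[K HK] : forall i : seq G * nat, exists k,
   [/\ unit_kernel M k, forall s, s \in i.1 -> 1 - k s 1%g < i.2.+1%:R^-1 &
      exists g, d < 1 - k g 1%g].
  move=> i; apply: contrapT => Hi; apply: H; exists i.1, i.2.+1%:R^-1.
  split=> [|k kM kC g]; first by rewrite invr_gt0.
  rewrite leNgt; apply/negP => kg; apply: Hi; exists k; split=> //.
  by exists g.
apply: (@kernels_not_uniform M d K) => // i; by have [] := HK i.
Qed.

End UniformKernels.

(** * Invariant vectors in unitary representations *)

Section HilbertGeometry.
Variables (R : realType) (V : hilbertSpace R).
Implicit Types (u v w : V).

Local Notation dot := (hilbert_dot V).
Definition hre u v : R := Re (dot u v).
Definition hsq v : R := hre v v.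
Definition hnorm v : R := Num.sqrt (hsq v).
Definition csq (z : R[i]) : R := Re z ^+ 2 + Im z ^+ 2.

Lemma csq_ge0 z : 0 <= csq z.
Proof. by rewrite addr_ge0 ?sqr_ge0. Qed.

Lemma csqM z z' : csq (z * z') = csq z * csq z'.
Proof. by case: z z' => a b [c d]; rewrite /csq /=; ring. Qed.

Lemma csq_real (r : R) : csq r%:C = r ^+ 2.
Proof. by rewrite /csq /= expr0n /= addr0. Qed.

Lemma csq_eq0 z : (csq z == 0) = (z == 0).
Proof. by rewrite /csq paddr_eq0 ?sqr_ge0 // !sqrf_eq0 eq_complex. Qed.

Lemma mul_conj z : z * (z^*)%R = (csq z)%:C.
Proof. by case: z => a b; simpc; rewrite /csq /=; congr (_ +i* _); ring. Qed.

Lemma dotDl u v w : dot (u + v) w = dot u w + dot v w.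
Proof. exact: linearDl. Qed.
Lemma dotDr u v w : dot u (v + w) = dot u v + dot u w.
Proof. exact: linearDr. Qed.
Lemma dotNl u v : dot (- u) v = - dot u v.
Proof. exact: linearNl. Qed.
Lemma dotBl u v w : dot (u - v) w = dot u w - dot v w.
Proof. by rewrite dotDl dotNl. Qed.
Lemma dotZl c u v : dot (c *: u) v = c * dot u v.
Proof. exact: linearZl_LR. Qed.
Lemma dotZr c u v : dot u (c *: v) = (c^*)%R * dot u v.
Proof. exact: linearZr_LR. Qed.
Lemma dotC u v : dot u v = ((dot v u)^*)%R.
Proof. by rewrite hermC /= expr0 mul1r. Qed.
Lemma dot0l v : dot 0 v = 0.
Proof. exact: linear0l. Qed.
Lemma dot0r v : dot v 0 = 0.
Proof. exact: linear0r. Qed.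
Lemma dot_suml I (s : seq I) (F : I -> V) v :
  dot (\sum_(i <- s) F i) v = \sum_(i <- s) dot (F i) v.
Proof. by rewrite (big_morph (dot^~ v) (fun a b => dotDl a b v) (dot0l v)). Qed.
Lemma dot_sumr I (s : seq I) (F : I -> V) v :
  dot v (\sum_(i <- s) F i) = \sum_(i <- s) dot v (F i).
Proof. by rewrite (big_morph (dot v) (fun a b => dotDr v a b) (dot0r v)). Qed.

Lemma dot_diag v : dot v v = (hsq v)%:C.
Proof.
rewrite /hsq /hre; have := dotC v v; case: (dot v v) => a b [] /= h.
by congr (_ +i* _); lra.
Qed.

Lemma hsq_ge0 v : 0 <= hsq v.
Proof. by have := dnorm_ge0 dot v; rewrite /= dot_diag ler0c. Qed.

Lemma hsq_eq0 v : (hsq v == 0) = (v == 0).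
Proof.
have := dnorm_eq0 dot v; rewrite /= dot_diag => <-.
by rewrite eq_complex /= eqxx andbT.
Qed.

Lemma hsq0 : hsq 0 = 0.
Proof. by apply/eqP; rewrite hsq_eq0. Qed.

Lemma hnormE v : `|v| = (hnorm v)%:C.
Proof.
apply/eqP; rewrite -(@eqrXn2 _ 2) ?ler0c ?sqrtr_ge0 //.
by rewrite hilbert_normE dot_diag -rmorphXn /= sqr_sqrtr ?hsq_ge0.
Qed.

Lemma hnorm_ge0 v : 0 <= hnorm v. Proof. exact: sqrtr_ge0. Qed.

Lemma hnorm_sqr v : hnorm v ^+ 2 = hsq v.
Proof. by rewrite sqr_sqrtr ?hsq_ge0. Qed.

Lemma hnormD u v : hnorm (u + v) <= hnorm u + hnorm v.
Proof. by have := ler_normD u v; rewrite !hnormE -rmorphD lecR. Qed.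

Lemma hreC u v : hre u v = hre v u.
Proof. by rewrite /hre dotC; case: (dot v u). Qed.
Lemma hreDl u v w : hre (u + v) w = hre u w + hre v w.
Proof. by rewrite /hre dotDl; case: (dot u w) (dot v w) => a b []. Qed.
Lemma hreNl u v : hre (- u) v = - hre u v.
Proof. by rewrite /hre dotNl; case: (dot u v). Qed.
Lemma hreZl (r : R) u v : hre (r%:C *: u) v = r * hre u v.
Proof. by rewrite /hre dotZl; case: (dot u v) => a b /=; rewrite mul0r subr0. Qed.
Lemma hreDr u v w : hre u (v + w) = hre u v + hre u w.
Proof. by rewrite !(hreC u) hreDl. Qed.
Lemma hreNr u v : hre u (- v) = - hre u v.
Proof. by rewrite !(hreC u) hreNl. Qed.
Lemma hreZr (r : R) u v : hre u (r%:C *: v) = r * hre u v.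
Proof. by rewrite !(hreC u) hreZl. Qed.

Lemma hsqD u v : hsq (u + v) = hsq u + hre u v *+ 2 + hsq v.
Proof. by rewrite /hsq hreDl !hreDr (hreC v u); ring. Qed.
Lemma hsqN v : hsq (- v) = hsq v.
Proof. by rewrite /hsq hreNl hreNr opprK. Qed.
Lemma hsqB u v : hsq (u - v) = hsq u - hre u v *+ 2 + hsq v.
Proof. by rewrite hsqD hsqN hreNr mulNrn. Qed.
Lemma hsqBC u v : hsq (u - v) = hsq (v - u).
Proof. by rewrite -hsqN opprB. Qed.

Lemma hsqZ c v : hsq (c *: v) = csq c * hsq v.
Proof.
have : (hsq (c *: v))%:C = (csq c * hsq v)%:C :> R[i].
  by rewrite -dot_diag dotZl dotZr mulrA dot_diag mul_conj rmorphM.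
by case.
Qed.

Lemma hsqD_le u v : hsq (u + v) <= hsq u *+ 2 + hsq v *+ 2.
Proof. by rewrite hsqD; have := hsq_ge0 (u - v); rewrite hsqB; lra. Qed.

(** Expand the squared norm of |v|^2 u - <u, v> v, which is |v|^2 times the defect of the
    inequality. *)
Lemma dot_CS u v : csq (dot u v) <= hsq u * hsq v.
Proof.
have [->|v0] := eqVneq v 0; first by rewrite dot0r hsq0 mulr0 /csq /= expr0n addr0.
have q0 : 0 < hsq v by rewrite lt0r hsq_eq0 v0 hsq_ge0.
have := hsq_ge0 ((hsq v)%:C *: u - dot u v *: v).
have e : hre u (dot u v *: v) = csq (dot u v) by rewrite /hre dotZr mulrC mul_conj.
rewrite hsqB !hsqZ hreZl csq_real e => h.
have : 0 <= hsq v * (hsq u * hsq v - csq (dot u v)) by lra.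
by rewrite pmulr_rge0 // subr_ge0.
Qed.

Lemma gram_psd_kernel (X : Type) (f : X -> V) : psd_kernel (fun x y => hre (f x) (f y)).
Proof.
split=> [x y|s]; first exact: hreC.
have -> : kform (fun x y => hre (f x) (f y)) s s = hsq (\sum_(p <- s) p.1%:C *: f p.2).
  rewrite /hsq /hre dot_suml (big_morph Re (id1 := 0) (op1 := +%R)) //; last first.
    by case=> a b [].
  rewrite /kform; apply: eq_bigr => p _.
  rewrite dot_sumr (big_morph Re (id1 := 0) (op1 := +%R)) //; last by case=> a b [].
  apply: eq_bigr => r _; by rewrite -!/(hre _ _) hreZl hreZr mulrA.
exact: hsq_ge0.
Qed.

Definition approx_closed (C : set V) :=
  forall v, (forall e : R, 0 < e -> exists u, C u /\ hsq (v - u) < e) -> C v.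
Definition midpoint_convex (C : set V) :=
  forall u v, C u -> C v -> C (2^-1 *: (u + v)).

Lemma hsq_complete (v : nat -> V) :
  (forall e : R, 0 < e -> exists N, forall p r, (N <= p)%N -> (N <= r)%N ->
     hsq (v p - v r) < e) ->
  exists l, forall e : R, 0 < e -> exists N, forall p, (N <= p)%N -> hsq (l - v p) < e.
Proof.
move=> H.
have small u (e : R[i]) : 0 < e -> (`|u| < e) = (hsq u < Re e ^+ 2).
  case: e => a b; rewrite ltcE /= => /andP[/eqP -> a0].
  rewrite hnormE ltcR -(@ltr_pXn2r _ 2) ?nnegrE ?hnorm_ge0 ?(ltW a0) //.
  by rewrite hnorm_sqr.
have : cvg (v @ \oo).
  apply: cauchy_cvg; apply/cauchy_ballP => e e0.
  have er : 0 < Re e ^+ 2 by rewrite exprn_gt0 //; move: e0; rewrite ltcE => /andP[].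
  have [N HN] := H _ er.
  exists (v @` [set p | (N <= p)%N], v @` [set p | (N <= p)%N]).
    by split; exists N => // p /= Np; exists p.
  move=> [_ _] /= [[p Np <-] [r Nr <-]].
  by rewrite -ball_normE /ball_ /= small // HN.
move=> /cvg_ex[l vl]; exists l => e e0.
have e1 : 0 < (Num.sqrt e)%:C :> R[i] by rewrite ltcR sqrtr_gt0.
move/cvgrPdist_lt : vl => /(_ _ e1) [N _ HN]; exists N => p Np.
by have := HN p Np; rewrite /= small //= sqr_sqrtr // ltW.
Qed.

Lemma hsq_mid u v : hsq (2^-1 *: (u + v)) = (hsq u + hsq v) / 2 - hsq (u - v) / 4.
Proof.
have -> : (2^-1 : R[i]) = (2^-1)%:C by rewrite fmorphV rmorphMn.
by rewrite hsqZ csq_real hsqD hsqB; field.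
Qed.

(** By the identity [hsq_mid], midpoints alone force a minimizing sequence to be Cauchy. *)
Lemma min_norm (C : set V) : C !=set0 -> approx_closed C -> midpoint_convex C ->
  exists v, C v /\ forall u, C u -> hsq v <= hsq u.
Proof.
move=> [c0 Cc0] Ccl Ccv; pose S := hsq @` C; pose m := inf S.
have S_inf : has_inf S.
  by split; [exists (hsq c0); exists c0|exists 0 => _ [u _ <-]; exact: hsq_ge0].
have m_le u : C u -> m <= hsq u.
  by move=> Cu; apply: ge_inf; [exact: (proj2 S_inf)|exists u].
have /choice[v Hv] : forall n : nat, exists u, C u /\ hsq u < m + n.+1%:R^-1.
  move=> n; have n0 : 0 < n.+1%:R^-1 :> R by rewrite invr_gt0.
  by have [_ [u Cu <-] h] := inf_adherent n0 S_inf; exists u.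
have bnd p r : hsq (v p - v r) <= p.+1%:R^-1 *+ 2 + r.+1%:R^-1 *+ 2.
  have [Cp hp] := Hv p; have [Cr hr] := Hv r.
  have := m_le _ (Ccv _ _ Cp Cr); rewrite hsq_mid.
  by move: (p.+1%:R^-1) (r.+1%:R^-1) hp hr => x y; lra.
have arch (e : R) : 0 < e -> exists N : nat, forall p, (N <= p)%N -> p.+1%:R^-1 < e.
  move=> e0; exists (truncn e^-1) => p Np.
  rewrite -[ltRHS]invrK ltf_pV2 ?posrE ?invr_gt0 //.
  by apply: lt_le_trans (truncnS_gt _) _; rewrite ler_nat.
have [|l Hl] := hsq_complete (v := v).
  move=> e e0; have [|N HN] := arch (e / 4); first by rewrite divr_gt0.
  exists N => p r Np Nr; apply: le_lt_trans (bnd p r) _.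
  have := HN _ Np; have := HN _ Nr.
  by move: (p.+1%:R^-1) (r.+1%:R^-1) => x y; lra.
have Cl : C l.
  apply: Ccl => e e0; have [N HN] := Hl e e0; exists (v N).
  by split; [exact: (proj1 (Hv N))|exact: HN].
exists l; split=> // u Cu; apply: le_trans (m_le _ Cu).
have [lm|ml] := leP (hsq l) m; first by [].
exfalso.
have m0 : 0 <= m by apply: lb_le_inf => [|_ [w _ <-]]; [exists (hsq c0); exists c0|exact: hsq_ge0].
have sml : Num.sqrt m < hnorm l by rewrite ltr_sqrt // (le_lt_trans m0).
(* Some [v n] of norm below sqrt m + e lies within [e] of [l], which would give |l| < sqrt m + 2e =
   |l|. *)
pose e := (hnorm l - Num.sqrt m) / 2.
have e0 : 0 < e by rewrite divr_gt0 // subr_gt0.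
have [N1 H1] := Hl _ (exprn_gt0 2 e0); have [N2 H2] := arch _ (exprn_gt0 2 e0).
pose n := maxn N1 N2.
have := H1 n (leq_maxl _ _); have := H2 n (leq_maxr _ _) => h2 h1.
have := hnormD (l - v n) (v n); rewrite subrK.
have h3 : hnorm (l - v n) < e.
  by rewrite -(@ltr_pXn2r _ 2) ?nnegrE ?hnorm_ge0 ?(ltW e0) // hnorm_sqr.
have h4 : hnorm (v n) < Num.sqrt m + e.
  rewrite -(@ltr_pXn2r _ 2) ?nnegrE ?hnorm_ge0 ?addr_ge0 ?sqrtr_ge0 ?(ltW e0) //.
  rewrite hnorm_sqr sqrrD sqr_sqrtr //.
  have := proj2 (Hv n); have : 0 <= Num.sqrt m * e *+ 2.
    by rewrite mulrn_wge0 // mulr_ge0 ?sqrtr_ge0 ?(ltW e0).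
  by move: (n.+1%:R^-1) h2 => x; lra.
by rewrite /e in h3 h4 *; lra.
Qed.

End HilbertGeometry.

(** * Orthogonal projections onto fixed vectors *)

Section InvariantProjection.
Variables (R : realType) (G : groupType) (V : hilbertSpace R) (pi : unitaryRep G V).
Implicit Types (u v w : V) (D : subgroup G) (g : G).

Local Notation dot := (hilbert_dot V).

Lemma rep1 v : pi 1%g v = v.
Proof.
have [[f fK _] _] := rep_unitary pi 1%g.
by rewrite -[RHS]fK -[in RHS](mul1g 1%g) rep_mul fK.
Qed.

Lemma repK g v : pi g^-1%g (pi g v) = v.
Proof. by rewrite -rep_mul mulVg rep1. Qed.

Lemma repVK g v : pi g (pi g^-1%g v) = v.
Proof. by rewrite -rep_mul mulgV rep1. Qed.

Lemma rep_dot g u v : dot (pi g u) (pi g v) = dot u v.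
Proof. by have [_ ->] := rep_unitary pi g. Qed.

Lemma rep_adj g u v : dot (pi g u) v = dot u (pi g^-1%g v).
Proof. by rewrite -{1}(repVK g v) rep_dot. Qed.

Lemma rep_hsq g v : hsq (pi g v) = hsq v.
Proof. by rewrite /hsq /hre rep_dot. Qed.

Definition fixed_by (D : set G) v := forall d, D d -> pi d v = v.

Lemma fixed_linear D c u v : fixed_by D u -> fixed_by D v -> fixed_by D (c *: u + v).
Proof. by move=> Du Dv d Dd; rewrite linearP Du // Dv. Qed.

(** [p] is the point of least norm in the closed convex hull of the orbit. It is fixed, since the
    midpoint of [p] and [pi d p] would otherwise be shorter; the other two clauses hold on the orbit
    and pass to the hull. *)
Lemma invariant_projection D v : exists p,
  [/\ fixed_by D p, forall w, fixed_by D w -> dot (v - p) w = 0 &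
      forall r, (forall d, subgroup_set D d -> hsq (pi d v - v) <= r) -> hsq (p - v) <= r].
Proof.
(* As the hull is an intersection, a property of its points is proved by exhibiting one closed
   midpoint-convex set that contains the orbit. *)
pose hull u := forall S : set V, approx_closed S -> midpoint_convex S ->
  (forall d, subgroup_set D d -> S (pi d v)) -> S u.
have hull_cl : approx_closed hull.
  move=> u hu S Scl Scv Sv; apply: (Scl) => e e0.
  by have [w [hw we]] := hu e e0; exists w; split=> //; apply: hw.
have hull_cv : midpoint_convex hull.
  by move=> u w hu hw S Scl Scv Sv; apply: (Scv); [exact: hu|exact: hw].
have hull_v : hull v by move=> S _ _ /(_ 1%g (subgroup1 D)); rewrite rep1.
have [p [hp pmin]] : exists p, hull p /\ forall u, hull u -> hsq p <= hsq u.
  by apply: min_norm => //; exists v.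
have hull_pi d u : subgroup_set D d -> hull u -> hull (pi d u).
  move=> Dd hu S Scl Scv Sv; apply: (hu (fun w => S (pi d w))).
  - move=> w hw; apply: Scl => e e0; have [x [Sx xe]] := hw e e0.
    by exists (pi d x); split=> //; rewrite -linearB rep_hsq.
  - by move=> w x Sw Sx; rewrite linearZ linearD; apply: Scv.
  - by move=> d' Dd'; rewrite -rep_mul; apply/Sv/subgroupM.
exists p; split.
- move=> d Dd; apply/eqP; rewrite -subr_eq0 -hsq_eq0; apply/eqP/le_anti.
  rewrite hsq_ge0 andbT.
  have := pmin _ (hull_cv _ _ (hull_pi _ _ Dd hp) hp).
  by rewrite hsq_mid rep_hsq; lra.
- move=> w Dw; suff e : dot p w = dot v w by rewrite dotBl e subrr.
  apply: (hp (fun x => dot x w = dot v w)).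
  + move=> x hx; apply/eqP; rewrite -subr_eq0 -csq_eq0; apply/eqP/le_anti.
    rewrite csq_ge0 andbT; apply/ler_addgt0Pr => e e0; rewrite add0r.
    have d0 : 0 < e / (hsq w + 1) by rewrite divr_gt0 //; have := hsq_ge0 w; lra.
    have [y [<- hy]] := hx _ d0; rewrite -dotBl; apply: le_trans (dot_CS _ _) _.
    have hw := hsq_ge0 w; rewrite -[leRHS](divfK (x := hsq w + 1)); last first.
      by rewrite gt_eqF //; lra.
    by apply: ler_pM; rewrite ?hsq_ge0 ?(ltW hy) //; lra.
  + move=> x y hx hy; rewrite dotZl dotDl hx hy.
    by field.
  + by move=> d Dd; rewrite rep_adj Dw //; exact: subgroupV.
- move=> r hr; apply: (hp (fun x => hsq (x - v) <= r)) => //.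
  + have r0 : 0 <= r by apply: le_trans (hr 1%g (subgroup1 D)); exact: hsq_ge0.
    move=> x hx; rewrite -hnorm_sqr -[leRHS]sqr_sqrtr //.
    rewrite ler_pXn2r ?nnegrE ?hnorm_ge0 ?sqrtr_ge0 //.
    apply/ler_addgt0Pr => e e0.
    have [y [hy xy]] := hx _ (exprn_gt0 2 e0).
    have -> : x - v = (y - v) + (x - y) by rewrite [RHS]addrC subrKA.
    apply: le_trans (hnormD _ _) _; apply: lerD; first exact: ler_wsqrtr.
    by rewrite -[e]ger0_norm ?(ltW e0) // -sqrtr_sqr ler_wsqrtr // ltW.
  + move=> x y hx hy.
    have -> : 2^-1 *: (x + y) - v = 2^-1 *: ((x - v) + (y - v)).
      rewrite addrACA -opprD -mulr2n scalerBr -[v *+ 2]scaler_nat scalerA.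
      by rewrite mulVf ?scale1r // pnatr_eq0.
    by rewrite hsq_mid; have := hsq_ge0 (x - v - (y - v)); lra.
Qed.

Definition proj D v : V := projT1 (cid (invariant_projection D v)).

Lemma proj_fixed D v : fixed_by D (proj D v).
Proof. by rewrite /proj; case: cid => p []. Qed.

Lemma proj_orth D v w : fixed_by D w -> dot (v - proj D v) w = 0.
Proof. by rewrite /proj; case: cid => p [] /= _ h _; exact: h. Qed.

Lemma proj_near D v r : (forall d, subgroup_set D d -> hsq (pi d v - v) <= r) ->
  hsq (proj D v - v) <= r.
Proof. by rewrite /proj; case: cid => p [] /= _ _; exact. Qed.

Lemma proj_uniq D v p : fixed_by D p ->
  (forall w, fixed_by D w -> dot (v - p) w = 0) -> proj D v = p.
Proof.
move=> Dp hp; apply/eqP; rewrite -subr_eq0 -hsq_eq0.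
have Dq : fixed_by D (proj D v - p).
  rewrite addrC -scaleN1r; apply: fixed_linear => //; exact: proj_fixed.
have : dot (proj D v - p) (proj D v - p) = 0.
  rewrite -[X in dot X _](subrKA v) dotDl hp // addr0 -opprB dotNl.
  by rewrite proj_orth // oppr0.
by rewrite dot_diag => -[->].
Qed.

Lemma proj_id D v : fixed_by D v -> proj D v = v.
Proof. by move=> Dv; apply: proj_uniq => // w _; rewrite subrr dot0l. Qed.

Lemma proj_linear D : linear (proj D).
Proof.
move=> c u v; apply: proj_uniq => [|w Dw].
  by apply: fixed_linear; exact: proj_fixed.
have -> : c *: u + v - (c *: proj D u + proj D v) =
    c *: (u - proj D u) + (v - proj D v).
  by rewrite opprD addrACA -scalerBr.
by rewrite dotDl dotZl !proj_orth // mulr0 addr0.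
Qed.

HB.instance Definition _ D := GRing.isLinear.Build R[i] V V _ (proj D) (proj_linear D).

Lemma proj_dot D u v : dot (proj D u) v = dot u (proj D v).
Proof.
have h x y : dot (proj D x) y = dot (proj D x) (proj D y).
  rewrite -{1}(subrK (proj D y) y) dotDr dotC (proj_orth y (@proj_fixed D x)).
  by rewrite rmorph0 add0r.
by rewrite h (dotC u) (h v u) -dotC.
Qed.

Lemma proj_hsq D v : hsq v = hsq (proj D v) + hsq (v - proj D v).
Proof.
have e : hsq v = hsq (v - proj D v + proj D v) by rewrite subrK.
rewrite e hsqD /hre (proj_orth v (@proj_fixed D v)) mul0rn addr0 addrC.
by [].
Qed.

Lemma proj_contract D v : hsq (proj D v) <= hsq v.
Proof. by rewrite [leRHS](proj_hsq D) lerDl hsq_ge0. Qed.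

Lemma proj_rep D g v :
  (forall d, subgroup_set D d -> forall w, fixed_by D w -> pi d (pi g w) = pi g w) ->
  (forall d, subgroup_set D d -> forall w, fixed_by D w -> pi d (pi g^-1%g w) = pi g^-1%g w) ->
  proj D (pi g v) = pi g (proj D v).
Proof.
move=> gD gVD; apply: proj_uniq => [d Dd|w Dw].
  by apply: gD => //; exact: proj_fixed.
rewrite -linearB rep_adj proj_orth // => d Dd; exact: gVD.
Qed.

Lemma normal_fixed (M : normalSubgroup G) g d w : subgroup_set M d ->
  fixed_by M w -> pi d (pi g w) = pi g w.
Proof.
move=> Md Mw; rewrite -rep_mul.
have -> : (d * g = g * d ^ g)%g by rewrite conjgE !mulgA mulgV mul1g.
by rewrite rep_mul Mw //; exact: normalJ.
Qed.

Lemma proj_normal (M : normalSubgroup G) g v : proj M (pi g v) = pi g (proj M v).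
Proof. by apply: proj_rep => d Md w; exact: normal_fixed. Qed.

End InvariantProjection.

(** The projection [p] of [v] to the [M]-fixed vectors has norm at least 1/2, and its normalized
    coefficient is a unit kernel. Uniformity with constant 1/8 lets [G] move [p] by at most half its
    norm, so the [G]-invariant projection of [p] is nonzero. *)
Theorem invariant_vector_of_near (R : realType) (G : groupType) (M : normalSubgroup G)
    (V : hilbertSpace R) (pi : unitaryRep G V) :
  kazhdan_mod R M ->
  (forall (C : seq G) (e : R), 0 < e -> exists v, [/\ hsq v = 1,
     forall s, s \in C -> hsq (pi s v - v) < e &
     forall m, subgroup_set M m -> hsq (pi m v - v) <= 4^-1]) ->
  has_nonzero_invariant_vector pi.
Proof.
move=> TM H.
have d0 : 0 < 8^-1 :> R by rewrite invr_gt0.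
have [C [e [e0 HC]]] := kernels_uniform d0 (@subgroupV _ M) (@normalJ _ M) TM.
(* Projecting to the [M]-fixed vectors does not increase displacements, and 1 - k is the squared
   displacement divided by [hsq p *+ 2], which is at least 1/2. *)
have [v [v1 vC vM]] := H C (e / 4) (divr_gt0 e0 (ltr0Sn _ 3)).
set p := proj pi M v.
have pv : hsq (p - v) <= 4^-1 by exact: proj_near.
have p14 : 4^-1 <= hsq p.
  have := hnormD p (v - p); rewrite addrC subrK.
  have -> : hnorm v = 1 by rewrite /hnorm v1 sqrtr1.
  have := hnorm_ge0 p; have := hnorm_ge0 (v - p); have := hnorm_sqr p.
  move: pv; rewrite hsqBC -(hnorm_sqr (v - p)).
  move: (hnorm p) (hnorm (v - p)) (hsq p) => a b c b2 <- b0 a0 ab.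
  have : b <= 2^-1 by nra.
  nra.
have p0 : 0 < hsq p by lra.
pose k g h := hre (pi g p) (pi h p) / hsq p.
have k1 g : 1 - k g 1%g = hsq (pi g p - p) / (hsq p *+ 2).
  by rewrite /k rep1 hsqB rep_hsq; field; rewrite gt_eqF.
have kM : unit_kernel M k.
  split.
  - have [kC kN] := gram_psd_kernel (fun g => pi g p); split=> [g h|s].
      by rewrite /k kC.
    have -> : kform k s s = kform (fun g h => hre (pi g p) (pi h p)) s s / hsq p.
      rewrite /kform mulr_suml; apply: eq_bigr => a _; rewrite mulr_suml.
      by apply: eq_bigr => b _; rewrite /k mulrA.
    by rewrite divr_ge0 // ltW.
  - by move=> s g h; rewrite /k /hre !rep_mul rep_dot.
  - by rewrite /k rep1 divff // gt_eqF.
  - move=> m Mm; rewrite /k rep1 (@proj_fixed _ _ _ pi M v m Mm).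
    by rewrite divff // gt_eqF.
have near : forall g, 1 - k g 1%g <= 8^-1.
  apply: HC => // s sC; rewrite k1 ltr_pdivrMr; last lra.
  have -> : pi s p - p = proj pi M (pi s v - v).
    by rewrite linearB /= proj_normal.
  apply: le_lt_trans (proj_contract _ _ _) _; apply: lt_le_trans (vC s sC) _.
  by nra.
pose q := proj pi (full_subgroup G) p.
have qp : hsq (q - p) <= hsq p / 4.
  apply: proj_near => g _; have := near g; rewrite k1 ler_pdivrMr; last lra.
  by lra.
exists q; split; last by move=> g; apply: proj_fixed.
apply/eqP => q0; move: qp; rewrite q0 sub0r hsqN; lra.
Qed.

Lemma near_unit_vectors (R : realType) (G : groupType) (V : hilbertSpace R)
  (pi : unitaryRep G V) :
  almost_invariant_vectors pi -> forall (C : seq G) (e : R), 0 < e ->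
  exists v, hsq v = 1 /\ forall s, s \in C -> hsq (pi s v - v) < e.
Proof.
move=> AI C e e0.
have e1 : 0 < Num.sqrt e by rewrite sqrtr_gt0.
have [v [v1 vC]] := AI [set` C] _ (finite_seq _) e1; exists v; split.
  by move: v1; rewrite hnormE => -[] v1; rewrite -hnorm_sqr v1 expr1n.
move=> s sC; have := vC s sC; rewrite hnormE ltcR => h.
rewrite -hnorm_sqr -[ltRHS]sqr_sqrtr ?(ltW e0) //.
by rewrite ltr_pXn2r ?nnegrE ?hnorm_ge0 // ltW.
Qed.

(** * Relative tensor squares *)

Lemma closed_prim_root_exists (F : closedFieldType) n : n%:R != 0 :> F ->
  exists z : F, n.-primitive_root z.
Proof.
move=> nF; have n_gt0 : (0 < n)%N by case: n nF; rewrite ?eqxx.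
have [r] := closed_field_poly_normal ('X^n - 1 : {poly F}).
rewrite (monicP _) ?monicXnsubC // scale1r => rE.
have r1 : all n.-unity_root r by apply/allP=> z; rewrite -root_prod_XsubC -rE.
have [||z] := hasP (has_prim_root n_gt0 r1 _ _); last by exists z.
- by rewrite -separable_prod_XsubC -rE separable_Xn_sub_1.
- by rewrite -ltnS -(size_prod_XsubC r id) -rE size_XnsubC.
Qed.

(** Discriminant of the sum of |z_i + t A p_i|^2 / p_i, a nonnegative polynomial in the real
    variable [t], where A is the sum of the z_i. The second hypothesis matches the convention x / 0
    = 0. *)
Lemma sum_csq_CS (R : realType) (I : finType) (p : I -> R) (z : I -> R[i]) :
  (forall i, 0 <= p i) -> (forall i, p i = 0 -> z i = 0) ->
  csq (\sum_i z i) <= (\sum_i p i) * \sum_i (csq (z i) / p i).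
Proof.
move=> p0 pz; set A := \sum_i z i; set P := \sum_i p i; set S := \sum_i _.
have P0 : 0 <= P by apply: sumr_ge0.
have S0 : 0 <= S by apply: sumr_ge0 => i _; rewrite divr_ge0 ?csq_ge0.
have key t : 0 <= S + t * csq A *+ 2 + t ^+ 2 * (csq A * P).
  have reA : csq A = \sum_i (Re A * Re (z i) + Im A * Im (z i)).
    rewrite big_split -!mulr_sumr /csq !expr2; congr (_ * _ + _ * _).
      by rewrite /A (big_morph Re (id1 := 0) (op1 := +%R)) //; case=> a b [].
    by rewrite /A (big_morph Im (id1 := 0) (op1 := +%R)) //; case=> a b [].
  rewrite {1}reA /S /P mulr_sumr -sumrMnl mulr_sumr mulr_sumr -!big_split /=.
  apply: sumr_ge0 => i _; have [i0|i0] := eqVneq (p i) 0.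
    by rewrite pz // i0 /csq /= expr0n /=; lra.
  have ip : 0 < p i by rewrite lt0r i0 p0.
  have -> : csq (z i) / p i + t * (Re A * Re (z i) + Im A * Im (z i)) *+ 2 +
      t ^+ 2 * (csq A * p i) =
      ((Re (z i) + t * Re A * p i) ^+ 2 + (Im (z i) + t * Im A * p i) ^+ 2) / p i.
    by rewrite /csq; field.
  by rewrite divr_ge0 ?addr_ge0 ?sqr_ge0.
have := discriminant_le0 (mulr_ge0 (csq_ge0 A) P0) key.
have := csq_ge0 A; rewrite le_eqVlt => /predU1P[<- _|A0]; first exact: mulr_ge0.
by rewrite expr2 mulrCA ler_pM2l // mulrC.
Qed.

Lemma sum_CS (R : realType) (I : finType) (x y : I -> R) :
  \sum_i x i * y i <= Num.sqrt (\sum_i x i ^+ 2) * Num.sqrt (\sum_i y i ^+ 2).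
Proof.
have X0 : 0 <= \sum_i x i ^+ 2 by apply: sumr_ge0 => i _; rewrite sqr_ge0.
have Y0 : 0 <= \sum_i y i ^+ 2 by apply: sumr_ge0 => i _; rewrite sqr_ge0.
rewrite -sqrtrM //; apply: le_trans (ler_norm _) _; rewrite -sqrtr_sqr ler_wsqrtr //.
apply: discriminant_le0 => // t.
rewrite mulr_sumr -sumrMnl mulr_sumr -!big_split /=; apply: sumr_ge0 => i _.
by have := sqr_ge0 (x i + t * y i); lra.
Qed.

(** * The kernel of normalized rank-one tensors *)

Section TensorKernel.
Variables (R : realType) (V : hilbertSpace R).
Implicit Types (u v w : V).
Local Notation dot := (hilbert_dot V).

Lemma dotE u v : dot u v = hre u v +i* hre u ('i *: v).
Proof.
by rewrite /hre dotZr; case: (dot u v) => a b; simpc.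
Qed.

(** Induction on the length: removing the component along the first vector [a] splits off |a|^2
    times the squared norm of one combination of the second entries, and leaves a list whose first
    pair contributes nothing. *)
Lemma schur_product (s : seq (V * V)) :
  0 <= \sum_(p <- s) \sum_(q <- s) dot p.1 q.1 * dot q.2 p.2.
Proof.
have [n] := ubnP (size s); elim: n s => // n IH [|[a b] s] /=.
  by rewrite big_nil.
rewrite ltnS => sn.
have drop0 t c : \sum_(p <- (0, c) :: t) \sum_(q <- (0, c) :: t)
      dot p.1 q.1 * dot q.2 p.2 = \sum_(p <- t) \sum_(q <- t) dot p.1 q.1 * dot q.2 p.2.
  rewrite big_cons big1 ?add0r => [|q _]; last by rewrite dot0l mul0r.
  by apply: eq_bigr => p _; rewrite big_cons dot0r mul0r add0r.
have [->|a0] := eqVneq a 0; first by rewrite drop0 IH.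
have aa : (hsq a)%:C != 0 :> R[i] by rewrite eq_complex /= eqxx andbT hsq_eq0.
pose beta (p : V * V) := dot p.1 a / (hsq a)%:C.
pose f (p : V * V) : V * V := (p.1 - beta p *: a, p.2).
have fa p : dot (f p).1 a = 0.
  by rewrite dotBl dotZl dot_diag divfK ?subrr.
have dE p q : dot p.1 q.1 = dot (f p).1 (f q).1 + (hsq a)%:C * (beta p * (beta q)^*%R).
  have e (r : V * V) : r.1 = (f r).1 + beta r *: a by rewrite subrK.
  rewrite {1}(e p) {1}(e q); move: (f p).1 (f q).1 (fa p) (fa q) => x y xa ya.
  rewrite dotDl !dotDr !dotZl !dotZr dot_diag xa (dotC a) ya rmorph0 !mulr0.
  by rewrite addr0 add0r mulrA mulrC.
set t := (a, b) :: s.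
have -> : \sum_(p <- t) \sum_(q <- t) dot p.1 q.1 * dot q.2 p.2 =
  \sum_(p <- map f t) \sum_(q <- map f t) dot p.1 q.1 * dot q.2 p.2 +
  (hsq a)%:C * dot (\sum_(q <- t) (beta q)^*%R *: q.2) (\sum_(q <- t) (beta q)^*%R *: q.2).
  rewrite dot_sumr mulr_sumr big_map -big_split; apply: eq_bigr => p _.
  rewrite dot_suml mulr_sumr big_map -big_split; apply: eq_bigr => q _ /=.
  by rewrite dE mulrDl dotZl dotZr conjCK; congr (_ + _); ring.
apply: addr_ge0; last by rewrite dot_diag -rmorphM ler0c mulr_ge0 ?hsq_ge0.
have -> : map f t = (0, b) :: map f s.
  rewrite /= /f /=; congr ((_, _) :: _); apply/eqP; rewrite -hsq_eq0.
  have := fa (a, b); rewrite /f /= /beta /= dot_diag divff // scale1r.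
  by rewrite subrr hsq0.
by rewrite drop0 IH // size_map.
Qed.

(* The inner product of the rank-one tensors [u (x) u^* / |u|] and
   [v (x) v^* / |v|]; the convention [x / 0 = 0] makes it vanish when [u = 0]
   or [v = 0]. *)
Definition tker u v : R := csq (dot u v) / (hnorm u * hnorm v).

Lemma tker_ge0 u v : 0 <= tker u v.
Proof. by rewrite divr_ge0 ?csq_ge0 ?mulr_ge0 ?hnorm_ge0. Qed.

Lemma tkerC u v : tker u v = tker v u.
Proof.
rewrite /tker [hnorm u * _]mulrC dotC; congr (_ / _).
by case: (dot v u) => a b; rewrite /csq /= sqrrN.
Qed.

Lemma tker_le u v : tker u v <= hnorm u * hnorm v.
Proof.
rewrite /tker; have := mulr_ge0 (hnorm_ge0 u) (hnorm_ge0 v).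
rewrite le_eqVlt => /predU1P[<-|h]; first by rewrite invr0 mulr0.
by rewrite ler_pdivrMr // -expr2 exprMn !hnorm_sqr dot_CS.
Qed.

Lemma hnorm_eq0 v : hnorm v = 0 -> v = 0.
Proof. by move=> h; apply/eqP; rewrite -hsq_eq0 -hnorm_sqr h expr0n. Qed.

Lemma psd_tker : psd_kernel tker.
Proof.
split=> [u v|s]; first exact: tkerC.
pose f (p : R * V) : V * V := ((p.1 / hnorm p.2)%:C *: p.2, p.2).
have := schur_product (map f s); rewrite lecE => /andP[_].
rewrite /= big_map (big_morph Re (id1 := 0) (op1 := +%R)) //; last by case=> a b [].
congr (_ <= _); apply: eq_bigr => p _.
rewrite big_map (big_morph Re (id1 := 0) (op1 := +%R)) //; last by case=> a b [].
apply: eq_bigr => q _; rewrite /f /= dotZl dotZr (dotC q.2) /tker invfM.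
have -> : ((q.1 / hnorm q.2)%:C)^*%R = (q.1 / hnorm q.2)%:C :> R[i].
  by apply/eqP; rewrite eq_complex /= oppr0 !eqxx.
have m (x y z : R[i]) : x * (y * z) * (z^*)%R = x * y * (z * (z^*)%R) by ring.
by rewrite m mul_conj -!rmorphM /=; ring.
Qed.

(** When the norms agree, [hsq v - tker u v] is the squared distance from [u] to the line spanned by
    [v], and the second clause names the nearest point. *)
Lemma tker_defect u v : hsq u = hsq v -> forall (c : R[i]),
  hsq v - tker u v <= hsq (u - c *: v) /\
  hsq (u - (dot u v / (hsq v)%:C) *: v) = hsq v - tker u v.
Proof.
move=> uv c; have nuv : hnorm u = hnorm v by rewrite /hnorm uv.
rewrite /tker nuv -expr2 hnorm_sqr.
have E (e : R[i]) : hsq (u - e *: v) =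
    hsq v - Re (dot u v * (e^*)%R) *+ 2 + csq e * hsq v.
  by rewrite hsqB hsqZ uv /hre dotZr mulrC.
have [v0|v0] := eqVneq (hsq v) 0.
  have v00 : v = 0 by apply/eqP; rewrite -hsq_eq0 v0.
  rewrite v0 invr0 mulr0 subr0; split; first exact: hsq_ge0.
  by rewrite v00 scaler0 subr0 uv v00 hsq0.
have vp : 0 < hsq v by rewrite lt0r v0 hsq_ge0.
rewrite !E; case: (dot u v) c => a b [x y].
have -> : (a +i* b) / (hsq v)%:C = (a / hsq v) +i* (b / hsq v).
  rewrite -fmorphV /=; simpc; by [].
rewrite /csq /=; split; last by field.
rewrite -subr_ge0.
have -> : hsq v - (a * x - b * - y) *+ 2 + (x ^+ 2 + y ^+ 2) * hsq v -
  (hsq v - (a ^+ 2 + b ^+ 2) / hsq v) =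
  ((a - x * hsq v) ^+ 2 + (b - y * hsq v) ^+ 2) / hsq v by field.
by rewrite divr_ge0 ?addr_ge0 ?sqr_ge0 ?hsq_ge0.
Qed.

Lemma family_dot (I : finType) (a : I -> {linear V -> V}) :
  (forall v, \sum_i hsq (a i v) = hsq v) ->
  forall u v, \sum_i dot (a i u) (a i v) = dot u v.
Proof.
move=> aP; have re u v : \sum_i hre (a i u) (a i v) = hre u v.
  have := aP (u + v); under eq_bigr do rewrite linearD hsqD mulr2n.
  by rewrite !big_split /= !aP hsqD; lra.
move=> u v; rewrite dotE -!re; under [LHS]eq_bigr do rewrite dotE.
elim/big_rec3: _ => // i x y z _ ->; rewrite linearZ /=; simpc; by [].
Qed.

(** Weighted Cauchy-Schwarz with weights |a_i u| |a_i v|, whose sum is in turn at most |u| |v|. *)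
Lemma tker_refine (I : finType) (a : I -> {linear V -> V}) u v :
  (forall v, \sum_i hsq (a i v) = hsq v) ->
  tker u v <= \sum_i tker (a i u) (a i v).
Proof.
move=> aP; have S0 : 0 <= \sum_i tker (a i u) (a i v).
  by apply: sumr_ge0 => i _; exact: tker_ge0.
rewrite {1}/tker; have := mulr_ge0 (hnorm_ge0 u) (hnorm_ge0 v).
rewrite le_eqVlt => /predU1P[<-|h]; first by rewrite invr0 mulr0.
rewrite ler_pdivrMr // -(family_dot aP) mulrC.
apply: le_trans (sum_csq_CS (p := fun i => hnorm (a i u) * hnorm (a i v)) _ _) _.
- by move=> i; rewrite mulr_ge0 ?hnorm_ge0.
- move=> i /eqP; rewrite mulf_eq0 => /orP[/eqP/hnorm_eq0 ->|/eqP/hnorm_eq0 ->].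
    by rewrite dot0l.
  by rewrite dot0r.
apply: ler_wpM2r => //; apply: le_trans (sum_CS _ _) _.
under eq_bigr do rewrite hnorm_sqr; rewrite aP.
by under eq_bigr do rewrite hnorm_sqr; rewrite aP.
Qed.

Lemma tker_sum_le (I : finType) (a : I -> {linear V -> V}) u v :
  (forall v, \sum_i hsq (a i v) = hsq v) ->
  \sum_i tker (a i u) (a i v) <= hnorm u * hnorm v.
Proof.
move=> aP; apply: (@le_trans _ _ (\sum_i hnorm (a i u) * hnorm (a i v))).
  by apply: ler_sum => i _; exact: tker_le.
apply: le_trans (sum_CS _ _) _.
under eq_bigr do rewrite hnorm_sqr; rewrite aP.
by under eq_bigr do rewrite hnorm_sqr; rewrite aP.
Qed.

End TensorKernel.

Definition mk_linear (R : realType) (V : hilbertSpace R) (f : V -> V)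
  (fP : linear f) : {linear V -> V} :=
  HB.pack f (GRing.isLinear.Build R[i] V V _ f fP).

(** * Supremum of tensor kernels over families in the bicommutant of [pi(M)] *)

Section RelativeKernel.
Variables (R : realType) (G : groupType) (V : hilbertSpace R) (pi : unitaryRep G V).
Variable M : normalSubgroup G.
Implicit Types (u v w : V) (g : G).
Local Notation dot := (hilbert_dot V).

Definition commutes_with (T : V -> V) := forall m, subgroup_set M m ->
  forall v, T (pi m v) = pi m (T v).

Hypothesis M_comm : forall m, subgroup_set M m -> commutes_with (pi m).

(** [T] ranges over all linear maps commuting with [pi(M)], bounded or not. Since [pi(M)] is
    commutative, members of the bicommutant commute with [pi(M)] and hence with each other. *)
Definition bicommutant (a : V -> V) := forall T : {linear V -> V},
  commutes_with T -> forall v, a (T v) = T (a v).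

(** The second condition is the partition of unity sum a_i^* a_i = 1, written without adjoints. *)
Definition family (I : finType) (a : I -> {linear V -> V}) :=
  (forall i, bicommutant (a i)) /\ forall v, \sum_i hsq (a i v) = hsq v.

Definition relative_set u v : set R := [set x | exists (I : finType)
  (a : I -> {linear V -> V}), family a /\ x = \sum_i tker (a i u) (a i v)].

Definition relative_kernel u v : R := sup (relative_set u v).

Lemma family_id : family (fun _ : unit => idfun : {linear V -> V}).
Proof. by split=> // v; rewrite big_const card_unit /= addr0. Qed.

Lemma has_sup_relative u v : has_sup (relative_set u v).
Proof.
split.
  by eexists; exists unit, (fun=> idfun); split; [exact: family_id|reflexivity].
by exists (hnorm u * hnorm v) => _ [I [a [[_ aP] ->]]]; exact: tker_sum_le.
Qed.

Lemma relative_ub (I : finType) (a : I -> {linear V -> V}) u v : family a ->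
  \sum_i tker (a i u) (a i v) <= relative_kernel u v.
Proof.
move=> fa; apply: ub_le_sup; first exact: (proj2 (has_sup_relative u v)).
by exists I, a.
Qed.

Lemma relative_le u v x : (forall (I : finType) (a : I -> {linear V -> V}),
  family a -> \sum_i tker (a i u) (a i v) <= x) -> relative_kernel u v <= x.
Proof.
move=> H; apply: ge_sup; first exact: (proj1 (has_sup_relative u v)).
by move=> _ [I [a [fa ->]]]; exact: H.
Qed.

Lemma relative_le_norm u v : relative_kernel u v <= hnorm u * hnorm v.
Proof. by apply: relative_le => I a [_ aP]; exact: tker_sum_le. Qed.

Lemma tker_le_relative u v : tker u v <= relative_kernel u v.
Proof.
have := relative_ub u v family_id.
by rewrite big_const card_unit /= addr0.
Qed.

Lemma relativeC u v : relative_kernel u v = relative_kernel v u.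
Proof.
suff le x y : relative_kernel x y <= relative_kernel y x by apply/le_anti; rewrite !le.
apply: relative_le => I a fa; under eq_bigr do rewrite tkerC.
exact: relative_ub.
Qed.

Lemma bicommutant_commutes a : bicommutant a -> commutes_with a.
Proof. by move=> ba m Mm v; rewrite (ba (pi m)) //; exact: M_comm. Qed.

Section Refinement.
Variables (I J : finType) (a : I -> {linear V -> V}) (b : J -> {linear V -> V}).
Hypotheses (fa : family a) (fb : family b).

Definition refinement (p : I * J) : {linear V -> V} := b p.2 \o a p.1.

Lemma family_refinement : family refinement.
Proof.
split=> [[i j] T cT v|v] /=; first by rewrite (proj1 fa) // (proj1 fb).
rewrite -(pair_bigA_idem _ (fun i j => hsq (b j (a i v)))) /=; last by rewrite addr0.
by under eq_bigr do rewrite (proj2 fb); exact: (proj2 fa).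
Qed.

Lemma refinement_lel u v : \sum_i tker (a i u) (a i v) <=
  \sum_p tker (refinement p u) (refinement p v).
Proof.
rewrite -(pair_bigA_idem _ (fun i j => tker (b j (a i u)) (b j (a i v)))) /=;
  last by rewrite addr0.
by apply: ler_sum => i _; apply: tker_refine; exact: (proj2 fb).
Qed.

(** The two families commute, so the refinement of [a] by [b] is also one of [b] by [a]: families
    are directed. *)
Lemma refinement_ler u v : \sum_j tker (b j u) (b j v) <=
  \sum_p tker (refinement p u) (refinement p v).
Proof.
have comm i j w : b j (a i w) = a i (b j w).
  by apply: (proj1 fb); apply/bicommutant_commutes/(proj1 fa).
rewrite -(pair_bigA_idem _ (fun i j => tker (b j (a i u)) (b j (a i v)))) /=;
  last by rewrite addr0.
rewrite exchange_big; apply: ler_sum => j _ /=; under eq_bigr do rewrite !comm.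
by apply: tker_refine; exact: (proj2 fa).
Qed.

End Refinement.

(** Sums increase under refinement, so one common refinement nearly attains finitely many suprema at
    once. *)
Lemma relative_adherent (L : seq (V * V)) (e : R) : 0 < e ->
  exists (I : finType) (a : I -> {linear V -> V}), family a /\
  forall p, p \in L ->
    relative_kernel p.1 p.2 - e < \sum_i tker (a i p.1) (a i p.2).
Proof.
move=> e0; elim: L => [|p L [I [a [fa ha]]]].
  by exists unit, (fun=> idfun); split=> //; exact: family_id.
have [_ [J [b [fb ->]]] hb] := sup_adherent e0 (has_sup_relative p.1 p.2).
exists (prod I J), (refinement a b); split; first exact: family_refinement.
move=> q; rewrite inE => /predU1P[->|qL].
  exact: lt_le_trans hb (refinement_ler _ _ _ _).
exact: lt_le_trans (ha q qL) (refinement_lel _ _ _ _).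
Qed.

(** A single family approximates all entries of the finite form, and its own form is a sum of forms
    of [tker]; [W] bounds the accumulated error. *)
Lemma psd_relative : psd_kernel relative_kernel.
Proof.
split=> [u v|s]; first exact: relativeC.
pose W := \sum_(p <- s) \sum_(q <- s) `|p.1 * q.1|.
have W0 : 0 <= W by apply: sumr_ge0 => p _; apply: sumr_ge0.
apply/ler_addgt0Pr => e' e'0.
pose e := e' / (W + 1).
have e0 : 0 < e by rewrite divr_gt0 //; lra.
have eW : e * W <= e'.
  rewrite -[leRHS](divfK (x := W + 1)); last by rewrite gt_eqF //; lra.
  by rewrite ler_wpM2l ?(ltW e0) //; lra.
apply: (@le_trans _ _ (kform relative_kernel s s + e * W)); last by rewrite lerD2l.
have [I [a [fa ha]]] := relative_adherent [seq (p.2, q.2) | p <- s, q <- s] e0.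
have K0 : 0 <= \sum_(p <- s) \sum_(q <- s)
    p.1 * q.1 * \sum_i tker (a i p.2) (a i q.2).
  have -> : \sum_(p <- s) \sum_(q <- s) p.1 * q.1 * \sum_i tker (a i p.2) (a i q.2) =
    \sum_i kform (@tker R V) [seq (p.1, a i p.2) | p <- s] [seq (p.1, a i p.2) | p <- s].
    rewrite /kform; under [RHS]eq_bigr do rewrite big_map.
    rewrite [RHS]exchange_big; apply: eq_bigr => p _ /=.
    under [RHS]eq_bigr do rewrite big_map.
    by rewrite [RHS]exchange_big; apply: eq_bigr => q _ /=; rewrite mulr_sumr.
  by apply: sumr_ge0 => i _; exact: (proj2 (psd_tker V)).
apply: le_trans K0 _.
rewrite /kform /W mulr_sumr -big_split /= big_seq [leRHS]big_seq.
apply: ler_sum => p ps; rewrite mulr_sumr -big_split /= big_seq [leRHS]big_seq.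
apply: ler_sum => q qs.
have pq : (p.2, q.2) \in [seq (p.2, q.2) | p <- s, q <- s].
  by apply/allpairsP; exists (p, q).
have := ha _ pq; have := relative_ub p.2 q.2 fa => /=.
set S := \sum_i _; set Q := relative_kernel _ _ => SQ QS.
have := ler_norm (p.1 * q.1); have := ler_norm (- (p.1 * q.1)); rewrite normrN.
move: (p.1 * q.1) `|_| => x y xy yx.
have : 0 <= (y - x) * (Q - S) by rewrite mulr_ge0 //; lra.
have : 0 <= (y + x) * (e - (Q - S)) by rewrite mulr_ge0 //; lra.
have : 0 <= (y - x) * (e - (Q - S)) by rewrite mulr_ge0 //; lra.
have : 0 <= (y + x) * (Q - S) by rewrite mulr_ge0 //; lra.
lra.
Qed.

(** As [M] is normal, conjugation by [pi g] preserves the commutant of [pi(M)] and so carries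
    families to families. *)
Lemma relative_rep_le g u v :
  relative_kernel (pi g u) (pi g v) <= relative_kernel u v.
Proof.
apply: relative_le => I a fa.
pose b i : {linear V -> V} := pi g^-1%g \o (a i \o pi g).
have fb : family b.
  split=> [i T cT x|x] /=.
    pose T' : {linear V -> V} := pi g \o (T \o pi g^-1%g).
    have cT' : commutes_with T'.
      move=> m Mm y /=.
      have -> : pi g^-1%g (pi m y) = pi (m ^ g)%g (pi g^-1%g y).
        by rewrite -!rep_mul conjgE !mulgA mulgK.
      rewrite cT; last exact: normalJ.
      by rewrite -!rep_mul conjgE !mulgA mulgV mul1g.
    have := proj1 fa i T' cT' (pi g x); rewrite /= repK => ->.
    by rewrite repK.
  under eq_bigr do rewrite rep_hsq; rewrite (proj2 fa); exact: rep_hsq.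
have -> : \sum_i tker (a i (pi g u)) (a i (pi g v)) = \sum_i tker (b i u) (b i v).
  by apply: eq_bigr => i _; rewrite /tker /= rep_dot /hnorm !rep_hsq.
exact: relative_ub.
Qed.

Lemma relative_rep g u v :
  relative_kernel (pi g u) (pi g v) = relative_kernel u v.
Proof.
apply/le_anti; rewrite relative_rep_le /=.
by rewrite -{1}(repK pi g u) -{1}(repK pi g v) relative_rep_le.
Qed.

(** * Approximate spectral projections of one element of [M] *)

Section Fejer.
Variables (m : G) (Mm : subgroup_set M m) (p : nat) (z : R[i]).
Hypothesis zP : p.-primitive_root z.

Let p_gt0 : (0 < p)%N := prim_order_gt0 zP.
Let q : R[i] := p%:R^-1.

(** This average concentrates on the part of the spectrum of [pi m] near z^(-i). *)
Definition fejer_fun (i : 'I_p) v : V :=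
  \sum_(j < p) (q * z ^+ (i * j)) *: pi (m ^+ j)%g v.

Lemma fejer_linear i : linear (fejer_fun i).
Proof.
move=> c u v; rewrite /fejer_fun scaler_sumr -big_split; apply: eq_bigr => j _ /=.
by rewrite linearP scalerDr !scalerA [c * _]mulrC.
Qed.

Definition fejer i : {linear V -> V} := mk_linear (fejer_linear i).

Lemma memM_exp j : subgroup_set M (m ^+ j)%g.
Proof.
elim: j => [|j IH]; first by rewrite expg0; exact: subgroup1.
by rewrite expgS; exact: subgroupM.
Qed.

Lemma root_conj : z * (z^*)%R = 1.
Proof.
have h : `|z| ^+ p = 1 by rewrite -normrX (prim_expr_order zP) normr1.
have : `|z| = 1 by apply/eqP; rewrite -(pexpr_eq1 p_gt0) ?h ?normr_ge0.
by move=> z1; rewrite -normCK z1 expr1n.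
Qed.

Lemma root_orthogonality (j k : 'I_p) :
  \sum_(i < p) z ^+ (i * j) * ((z ^+ (i * k))^*)%R = if j == k then p%:R else 0.
Proof.
pose y := z ^+ j * ((z ^+ k)^*)%R.
have -> : \sum_(i < p) z ^+ (i * j) * ((z ^+ (i * k))^*)%R = \sum_(i < p) y ^+ i.
  apply: eq_bigr => i _; rewrite /y exprMn -!exprM ![(i * _)%N]mulnC.
  by congr (_ * _); rewrite [in LHS]exprM rmorphXn.
have yz : y * z ^+ k = z ^+ j.
  by rewrite /y -mulrA [_ * z ^+ k]mulrC rmorphXn -exprMn root_conj expr1n mulr1.
case: eqP => [jk|jk].
  have -> : y = 1 by rewrite /y jk rmorphXn -exprMn root_conj expr1n.
  under eq_bigr do rewrite expr1n; by rewrite sumr_const card_ord.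
have y1 : y != 1.
  apply/eqP => y1; move: yz; rewrite y1 mul1r => /eqP.
  rewrite (eq_prim_root_expr zP) !modn_small // => /eqP kj; apply: jk.
  exact/val_inj/esym.
apply/eqP; have : (y - 1) * \sum_(i < p) y ^+ i = 0.
  rewrite -subrX1 /y exprMn -rmorphXn -!exprM ![(_ * p)%N]mulnC !exprM.
  by rewrite (prim_expr_order zP) !expr1n rmorph1 mulr1 subrr.
by move/eqP; rewrite mulf_eq0 subr_eq0 (negPf y1).
Qed.

(** Orthogonality of the characters of Z/p cancels the cross terms and leaves [p] diagonal terms of
    size p / p^2. *)
Lemma family_fejer : family fejer.
Proof.
split=> [i T cT v|v].
  rewrite /= /fejer_fun linear_sum; apply: eq_bigr => j _.
  by rewrite linearZ cT //; exact: memM_exp.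
suff : \sum_i dot (fejer i v) (fejer i v) = dot v v.
  under eq_bigr do rewrite dot_diag.
  rewrite dot_diag -rmorph_sum; exact: complexI.
have qp : q * p%:R = 1 by rewrite mulVf // pnatr_eq0 -lt0n.
have -> : \sum_i dot (fejer i v) (fejer i v) =
    \sum_(j < p) \sum_(k < p) q * (q^*)%R * dot (pi (m ^+ j)%g v) (pi (m ^+ k)%g v) *
      \sum_(i < p) z ^+ (i * j) * ((z ^+ (i * k))^*)%R.
  under eq_bigr => i _.
    rewrite /= /fejer_fun dot_suml.
    under eq_bigr do rewrite dot_sumr.
    over.
  rewrite exchange_big; apply: eq_bigr => j _ /=.
  rewrite exchange_big; apply: eq_bigr => k _ /=.
  rewrite mulr_sumr; apply: eq_bigr => i _.
  by rewrite dotZl dotZr rmorphM; ring.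
under eq_bigr => j _.
  rewrite (bigD1 j) //= root_orthogonality eqxx big1 ?addr0; last first.
    by move=> k kj; rewrite root_orthogonality eq_sym (negPf kj) mulr0.
  rewrite rep_dot.
  over.
have qc : (q^*)%R * p%:R = 1.
  by rewrite -[p%:R](rmorph_nat Num.conj) -rmorphM qp rmorph1.
have e x : q * (q^*)%R * x * p%:R = q * x * ((q^*)%R * p%:R) by ring.
rewrite sumr_const card_ord e qc mulr1 -mulr_natl mulrA.
by rewrite [p%:R * _]mulrC qp mul1r.
Qed.

(** Applying [pi m] shifts the sum by one index, so the difference telescopes to its two end terms,
    each of norm |v| / p. *)
Lemma fejer_shift i v : hsq (fejer i (pi m v) - (z ^+ i)^-1 *: fejer i v) <=
  4 / p%:R ^+ 2 * hsq v.
Proof.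
have z0 : z != 0.
  by apply/eqP => z0; have := root_conj; rewrite z0 mul0r => /eqP; rewrite eq_sym oner_eq0.
have zi : z ^+ i != 0 by rewrite expf_neq0.
pose f j := (q * (z ^+ i)^-1 * z ^+ (i * j)) *: pi (m ^+ j)%g v.
have -> : fejer i (pi m v) - (z ^+ i)^-1 *: fejer i v = f p - f 0%N.
  rewrite -(telescope_sumr f (leq0n p)) big_mkord sumrB; congr (_ - _).
    rewrite /= /fejer_fun; apply: eq_bigr => j _; rewrite /f -rep_mul -expgSr.
    by congr (_ *: _); rewrite mulnS exprD; field.
  rewrite /= /fejer_fun scaler_sumr; apply: eq_bigr => j _; rewrite /f scalerA.
  by congr (_ *: _); ring.
rewrite /f muln0 expr0 expg0 rep1 mulr1 mulnC exprM (prim_expr_order zP) expr1n mulr1.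
rewrite -scalerBr hsqZ.
have -> : csq (q * (z ^+ i)^-1) = (p%:R ^+ 2)^-1.
  have cz : csq z = 1 by have := root_conj; rewrite mul_conj => -[].
  have czi : csq (z ^+ i) = 1.
    elim: (i : nat) => [|n IH]; rewrite ?exprS ?csqM ?cz ?IH ?mulr1 //.
    by rewrite /csq /= expr1n expr0n addr0.
  have := csqM (z ^+ i) (z ^+ i)^-1; rewrite mulfV // czi mul1r => h.
  rewrite csqM -h /q.
  have -> : (p%:R^-1 : R[i]) = (p%:R^-1)%:C by rewrite fmorphV rmorph_nat.
  by rewrite csq_real exprVn /csq /= expr1n expr0n addr0 mulr1.
rewrite [leRHS]mulrAC mulrC ler_wpM2r ?invr_ge0 ?exprn_ge0 //.
by apply: le_trans (hsqD_le _ _) _; rewrite hsqN rep_hsq; lra.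
Qed.

End Fejer.

(** On each of the [n] Fejer pieces [pi m] is nearly the scalar z^(-i), with defect at most 4/n^2
    times [hsq v]; the total 4/n tends to 0. *)
Lemma relative_fixed m v : subgroup_set M m -> relative_kernel (pi m v) v = hsq v.
Proof.
move=> Mm; apply/le_anti/andP; split.
  apply: le_trans (relative_le_norm _ _) _.
  by rewrite /hnorm rep_hsq -expr2 sqr_sqrtr ?hsq_ge0.
apply/ler_addgt0Pr => e e0.
pose n := (truncn (4 * hsq v / e)).+1.
have nz : n%:R != 0 :> R by rewrite pnatr_eq0.
have [|z zP] := @closed_prim_root_exists R[i] n; first by rewrite pnatr_eq0.
apply: (@le_trans _ _ (\sum_i tker (fejer m z i (pi m v)) (fejer m z i v) + e)); last first.
  by rewrite lerD2r; apply: relative_ub; exact: (family_fejer Mm zP).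
rewrite -lerBlDr; apply: (@le_trans _ _ (hsq v - 4 * hsq v / n%:R)).
  rewrite lerD2l lerN2 ler_pdivrMr ?ltr0n // [e * _]mulrC -ler_pdivrMr //.
  by apply/ltW/truncnS_gt.
have := proj2 (family_fejer Mm zP) v => fv.
have -> : hsq v - 4 * hsq v / n%:R =
    \sum_(i < n) (hsq (fejer m z i v) - 4 / n%:R ^+ 2 * hsq v).
  rewrite sumrB fv sumr_const card_ord -mulr_natl; congr (_ - _); by field.
apply: ler_sum => i _.
have hi : hsq (fejer m z i (pi m v)) = hsq (fejer m z i v).
  have fc := bicommutant_commutes (proj1 (family_fejer Mm zP) i).
  by rewrite fc // rep_hsq.
have [h _] := tker_defect hi ((z ^+ i)^-1).
have := fejer_shift m zP i v; move: (4 / _ * _) => t; lra.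
Qed.

Lemma relative_unit_kernel v : hsq v = 1 ->
  unit_kernel M (fun g h => relative_kernel (pi g v) (pi h v)).
Proof.
move=> v1; split.
- have [kC kN] := psd_relative; split=> [g h|s]; first exact: kC.
  have := kN [seq (p.1, pi p.2 v) | p <- s].
  rewrite /kform big_map; congr (_ <= _); apply: eq_bigr => p _.
  by rewrite big_map.
- by move=> s g h; rewrite /= !rep_mul relative_rep.
- by rewrite rep1 -{1}(rep1 pi v) relative_fixed //; exact: subgroup1.
- by move=> m Mm; rewrite rep1 relative_fixed.
Qed.

Lemma relative_lower v g : hsq v = 1 ->
  1 - relative_kernel (pi g v) v <= hsq (pi g v - v).
Proof.
move=> v1; have := tker_le_relative (pi g v) v.
rewrite /tker /hnorm rep_hsq v1 sqrtr1 mulr1 divr1 hsqB rep_hsq v1.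
have : hre (pi g v) v ^+ 2 <= csq (dot (pi g v) v) by rewrite lerDl sqr_ge0.
by have := sqr_ge0 (1 - hre (pi g v) v); nra.
Qed.

(** On the pieces of a family nearly attaining both suprema, [pi k v] and [pi l v] are close to
    multiples [al i] and [be i] of [v]. Scalars commute, so both products are close to the same
    multiple. Each total defect is at most 2d and enters with factor 8. *)
Lemma relative_commutator v k l d : hsq v = 1 ->
  commutes_with (pi k) -> commutes_with (pi l) -> 0 < d ->
  1 - d <= relative_kernel (pi k v) v -> 1 - d <= relative_kernel (pi l v) v ->
  hsq (pi (k * l)%g v - pi (l * k)%g v) <= 32 * d.
Proof.
move=> v1 ck cl d0 hk hl.
have [I [c [fc hc]]] := relative_adherent [:: (pi k v, v); (pi l v, v)] d0.
have := hc (pi k v, v); rewrite inE eqxx => /(_ isT) /= ck1.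
have := hc (pi l v, v); rewrite !inE eqxx orbT => /(_ isT) /= cl1.
pose al i := dot (c i (pi k v)) (c i v) / (hsq (c i v))%:C.
pose be i := dot (c i (pi l v)) (c i v) / (hsq (c i v))%:C.
have cc g i u : commutes_with (pi g) -> c i (pi g u) = pi g (c i u).
  by move=> cg; exact: (proj1 fc i (pi g) cg).
have csq1 g i : commutes_with (pi g) ->
    csq (dot (c i (pi g v)) (c i v) / (hsq (c i v))%:C) <= 1.
  move=> cg; have [->|h0] := eqVneq (hsq (c i v)) 0.
    by rewrite invr0 mulr0 /csq /= expr0n addr0.
  have hp : 0 < hsq (c i v) by rewrite lt0r h0 hsq_ge0.
  rewrite csqM; have -> : ((hsq (c i v))%:C^-1 : R[i]) = (hsq (c i v))^-1%:C.
    by rewrite fmorphV.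
  rewrite csq_real exprVn ler_pdivrMr ?exprn_gt0 // mul1r expr2.
  by apply: le_trans (dot_CS _ _) _; rewrite cc // rep_hsq.
have defect g : commutes_with (pi g) ->
    1 - d <= relative_kernel (pi g v) v ->
    relative_kernel (pi g v) v - d < \sum_i tker (c i (pi g v)) (c i v) ->
    \sum_i hsq (c i (pi g v) - (dot (c i (pi g v)) (c i v) / (hsq (c i v))%:C) *: c i v)
      <= 2 * d.
  move=> cg hg hg1.
  under eq_bigr => i _.
    have hi : hsq (c i (pi g v)) = hsq (c i v) by rewrite cc // rep_hsq.
    rewrite (proj2 (tker_defect hi 0)); over.
  by rewrite sumrB (proj2 fc) v1; lra.
have Sk := defect k ck hk ck1; have Sl := defect l cl hl cl1.
rewrite -(proj2 fc).
apply: (@le_trans _ _ (\sum_i (8 * hsq (c i (pi k v) - al i *: c i v) +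
                               8 * hsq (c i (pi l v) - be i *: c i v)))); last first.
  by rewrite big_split -!mulr_sumr /=; rewrite /al /be; lra.
apply: ler_sum => i _.
set x := c i (pi k v) - _; set y := c i (pi l v) - _.
have -> : c i (pi (k * l)%g v - pi (l * k)%g v) =
    (pi k y - pi l x) + (be i *: x - al i *: y).
  (* [P] and [Q] are the two products, [X] and [Y] their approximations with one factor replaced by
     its scalar, and [Z] the common multiple of [c i v]. *)
  have zl (P Q X Y Z : V) : P - Q = (P - X) - (Q - Y) + ((X - Z) - (Y - Z)).
    have -> : X - Z - (Y - Z) = X - Y by rewrite opprB addrA subrK.
    by rewrite opprB -addrA [Y - Q + _]addrC !subrKA.
  have lB g u w : pi g (u - w) = pi g u - pi g w by rewrite linearB.
  have lZ g a u : pi g (a *: u) = a *: pi g u by rewrite linearZ.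
  have ek : c i (pi k (pi l v)) = pi k (c i (pi l v)) by exact: cc.
  have el : c i (pi l (pi k v)) = pi l (c i (pi k v)) by exact: cc.
  rewrite linearB !rep_mul ek el {1}/y {1}/x !lB !lZ -!cc // /x /y !scalerBr.
  by rewrite !scalerA [al i * be i]mulrC; exact: zl.
have h1 := hsqD_le (pi k y - pi l x) (be i *: x - al i *: y).
have h2 := hsqD_le (pi k y) (- pi l x).
have h3 := hsqD_le (be i *: x) (- (al i *: y)).
have hx := csq1 l i cl; have hy := csq1 k i ck.
move: h2 h3; rewrite !hsqN !hsqZ !rep_hsq.
have : csq (be i) * hsq x <= hsq x by rewrite ler_piMl ?hsq_ge0.
have : csq (al i) * hsq y <= hsq y by rewrite ler_piMl ?hsq_ge0.
lra.
Qed.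

End RelativeKernel.

(** * Commutator subgroups *)

Section CommutingProjections.
Variables (R : realType) (V : hilbertSpace R) (L : Type) (mul : L -> L -> L).
Variable P : L -> {linear V -> V}.
Local Notation dot := (hilbert_dot V).
Hypothesis P_dot : forall x u v, dot (P x u) v = dot u (P x v).
Hypothesis P_idem : forall x v, P x (P x v) = P x v.
Hypothesis P_comm : forall x y v, P x (P y v) = P y (P x v).
Hypothesis P_mul : forall l x v, P l v = v -> P (mul l x) v = P x v.
Hypothesis P_div : forall l x v, P x v = v -> P (mul l x) v = v -> P l v = v.
Implicit Types (l x y : L) (u v w : V) (s : seq L).

Fixpoint projs s v := if s is l :: s' then P l (projs s' v) else v.

(** Each entry of [s] is used or skipped with probability 1/2, and the defect of the resulting
    random product is averaged. *)
Fixpoint cube_avg s x v : R := if s is l :: s' then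
  (cube_avg s' x v + cube_avg s' (mul l x) v) / 2 else hsq (v - P x v).

Lemma projsB s u v : projs s (u - v) = projs s u - projs s v.
Proof. by elim: s => //= l s ->; rewrite linearB. Qed.

Lemma projs_comm s x v : projs s (P x v) = P x (projs s v).
Proof. by elim: s => //= l s ->; rewrite P_comm. Qed.

Lemma projs_idem s v : projs s (projs s v) = projs s v.
Proof. by elim: s => //= l s IH; rewrite projs_comm IH P_idem. Qed.

Lemma projs_fixed s l v : List.In l s -> P l (projs s v) = projs s v.
Proof. by elim: s => //= y s IH [->|/IH h]; rewrite ?P_idem // P_comm h. Qed.

Lemma projs_dot s u v : dot (projs s u) v = dot u (projs s v).
Proof. by elim: s u v => //= l s IH u v; rewrite P_dot IH projs_comm. Qed.

Lemma projs_hsq s v : hsq v = hsq (projs s v) + hsq (v - projs s v).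
Proof.
have e : hsq v = hsq (projs s v + (v - projs s v)) by rewrite addrC subrK.
rewrite e hsqD /hre projs_dot projsB projs_idem subrr dot0r mul0rn addr0.
by [].
Qed.

Lemma P_hsq x v : hsq v = hsq (P x v) + hsq (v - P x v).
Proof. exact: (projs_hsq [:: x]). Qed.

Lemma cube_avg_split s r x v : cube_avg r x v =
  cube_avg r x (projs s v) + cube_avg r x (v - projs s v).
Proof.
elim: r x => [|l r IH] x /=; last by rewrite !(IH x) !(IH (mul l x)); lra.
rewrite (projs_hsq s) projsB projs_comm (linearB (P x)); congr (_ + hsq _).
by rewrite !opprB addrACA [RHS]addrACA [- P x v - _]addrC.
Qed.

Lemma cube_avg_fixed s x w : (forall l, List.In l s -> P l w = w) ->
  cube_avg s x w = hsq (w - P x w).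
Proof.
elim: s x => //= l s IH x fw; rewrite !IH; try by move=> y ys; apply: fw; right.
by rewrite P_mul; [lra|apply: fw; left].
Qed.

(** A union bound: what is fixed for [x] and for [mul l x] is fixed for [l], and the projections
    commute. *)
Lemma P_triangle l x w :
  hsq (w - P l w) <= hsq (w - P x w) + hsq (w - P (mul l x) w).
Proof.
set u := P x (P (mul l x) w).
have uf : P l u = u by apply: (P_div (x := x)); rewrite /u ?P_idem // P_comm P_idem.
apply: (@le_trans _ _ (hsq (w - u))).
  rewrite [leRHS](P_hsq l) (linearB (P l)) uf.
  have -> : w - u - (P l w - u) = w - P l w by rewrite opprB addrA subrK.
  by rewrite lerDr hsq_ge0.
rewrite (P_hsq x (w - u)) (linearB (P x)) {1}/u P_idem -(linearB (P x)).
have -> : w - u - P x (w - P (mul l x) w) = w - P x w.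
  by rewrite (linearB (P x)) /u opprB addrA subrK.
rewrite addrC lerD2l [leRHS](P_hsq x); rewrite lerDl; exact: hsq_ge0.
Qed.

(* Averaging over the products of subfamilies of [s]: a product of a random
   subfamily escapes a proper subgroup with probability at least 1/2. *)
Lemma cube_avg_ge s x v : hsq (v - projs s v) / 2 <= cube_avg s x v.
Proof.
elim: s x v => [|l s IH] x v /=; first by rewrite subrr hsq0 mul0r hsq_ge0.
set w := projs s v.
(* On [w], which all projections of [s] fix, the average is a single term; on [v - w], which their
   product kills, the induction hypothesis applies. *)
have low y : hsq (v - w) / 2 + hsq (w - P y w) <= cube_avg s y v.
  rewrite (cube_avg_split s) -/w addrC lerD //.
    rewrite cube_avg_fixed // => k ks; exact: projs_fixed.
  by have := IH y (v - w); rewrite projsB projs_idem subrr subr0.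
have h1 := low x; have h2 := low (mul l x); have h3 := P_triangle l x w.
have -> : hsq (v - P l w) = hsq (v - w) + hsq (w - P l w).
  rewrite (projs_hsq s) projsB projs_comm projs_idem -/w addrC; congr (hsq _ + _).
  by rewrite opprB addrA subrK.
lra.
Qed.

Lemma cube_avg_le (LL : L -> Prop) s x v r :
  (forall l y, LL l -> LL y -> LL (mul l y)) -> (forall l, List.In l s -> LL l) ->
  LL x -> (forall y, LL y -> hsq (v - P y v) <= r) -> cube_avg s x v <= r.
Proof.
move=> Lm sL Lx H; elim: s sL x Lx => [|l s IH] sL x Lx /=; first exact: H.
have Ll : LL l by apply: sL; left.
have {}IH := IH (fun l' h => sL l' (or_intror h)).
by have := IH x Lx; have := IH _ (Lm _ _ Ll Lx); lra.
Qed.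

End CommutingProjections.

(** * From uniform bounds on commutators to the commutator subgroup *)

Section CommutatorStep.
Variables (R : realType) (G : groupType) (V : hilbertSpace R) (pi : unitaryRep G V).
Variables (K L N : normalSubgroup G).
Let M := commutator K L.
Hypothesis LK : forall x, subgroup_set L x -> subgroup_set K x.
Hypothesis KMN : forall k m, subgroup_set K k -> subgroup_set M m ->
  subgroup_set N [~ k, m]%g.
Hypothesis piN : forall n, subgroup_set N n -> forall v, pi n v = v.
Implicit Types (u v w : V).
Local Notation dot := (hilbert_dot V).

Lemma commutator_mem k l : subgroup_set K k -> subgroup_set L l ->
  subgroup_set M [~ k, l]%g.
Proof. by move=> Kk Ll H HKL; apply: HKL; exists k => //; exists l. Qed.

Lemma commutator_sub m : subgroup_set M m -> subgroup_set K m.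
Proof.
apply=> _ [k Kk [l Ll <-]]; rewrite commgEl; apply: subgroupM.
  exact: subgroupV.
exact: normalJ.
Qed.

Lemma rep_commute k m : subgroup_set K k -> subgroup_set M m ->
  forall v, pi k (pi m v) = pi m (pi k v).
Proof.
by move=> Kk Mm v; rewrite -!rep_mul commgC rep_mul (piN (KMN Kk Mm)).
Qed.

Lemma rep_conj k m : subgroup_set K k -> subgroup_set M m ->
  forall v, pi (m ^ k)%g v = pi m v.
Proof.
by move=> Kk Mm v; rewrite conjgE !rep_mul -(rep_commute Kk Mm) repK.
Qed.

(** A vector fixed by this subgroup is one on which the commutators with the given [x] act trivially
    for all of [K] simultaneously. *)
Definition slice (x : G) : subgroup G := generated [set [~ k, x]%g | k in (K : set G)].

Lemma slice_fixedP x v :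
  fixed_by pi (slice x) v <-> forall k, subgroup_set K k -> pi [~ k, x]%g v = v.
Proof.
split=> [H k Kk|H d].
  by apply: H => S; apply; exists k.
pose S := @Subgroup G [set d | pi d v = v] (rep1 pi v)
  (fun a b (ha : pi a v = v) (hb : pi b v = v) =>
     etrans (rep_mul pi a b v) (etrans (congr1 (pi a) hb) ha))
  (fun a (ha : pi a v = v) =>
     etrans (congr1 (pi a^-1%g) (esym ha)) (repK pi a v)).
by move/(_ S); apply => _ [k Kk <-]; exact: H.
Qed.

Lemma slice_sub x : subgroup_set L x -> forall d, subgroup_set (slice x) d -> subgroup_set M d.
Proof. by move=> Lx d; apply=> _ [k Kk <-]; exact: commutator_mem. Qed.

(** [k, xy] = [k, y] [k, x]^y, and conjugation by [y] in [K] is invisible in [pi(M)] because [K, M]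
    acts trivially. *)
Lemma slice_mul x y k v : subgroup_set L x -> subgroup_set L y -> subgroup_set K k ->
  pi [~ k, x * y]%g v = pi [~ k, y]%g (pi [~ k, x]%g v).
Proof.
move=> Lx Ly Kk.
have -> : [~ k, x * y]%g = ([~ k, y] * [~ k, x] ^ y)%g.
  by rewrite !commgEl !conjgE !invgM !mulgA !mulgK.
by rewrite rep_mul rep_conj //; [exact: LK|exact: commutator_mem].
Qed.

Lemma slice_mull x k k' v : subgroup_set L x -> subgroup_set K k ->
  subgroup_set K k' -> pi [~ k * k', x]%g v = pi [~ k, x]%g (pi [~ k', x]%g v).
Proof.
move=> Lx Kk Kk'.
have -> : [~ k * k', x]%g = ([~ k, x] ^ k' * [~ k', x])%g.
  by rewrite !commgEl !conjgE !invgM !mulgA !mulgK.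
by rewrite rep_mul rep_conj //; exact: commutator_mem.
Qed.

Lemma slice_one x v : pi [~ 1, x]%g v = v.
Proof. by rewrite commgEl conj1g mulVg rep1. Qed.

(** Multiplicativity in [k] makes the operators of single commutators a group, so a bound on
    commutators covers the whole slice. *)
Lemma slice_orbit x d : subgroup_set L x -> subgroup_set (slice x) d ->
  exists k, subgroup_set K k /\ forall v, pi d v = pi [~ k, x]%g v.
Proof.
move=> Lx.
pose S0 := [set d | exists k, subgroup_set K k /\ forall v, pi d v = pi [~ k, x]%g v].
have S1 : S0 1%g.
  by exists 1%g; split; [exact: subgroup1|move=> v; rewrite slice_one rep1].
have SM a b : S0 a -> S0 b -> S0 (a * b)%g.
  move=> [k [Kk ka]] [k' [Kk' kb]]; exists (k * k')%g; split; first exact: subgroupM.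
  by move=> v; rewrite rep_mul ka kb slice_mull.
have SV a : S0 a -> S0 a^-1%g.
  move=> [k [Kk ka]]; have KV := subgroupV Kk; exists k^-1%g; split=> // v.
  rewrite -[v in RHS](repVK pi a) ka -slice_mull // mulVg.
  by rewrite slice_one.
pose S := Subgroup S1 SM SV.
by move/(_ S); apply => _ [k Kk <-]; exists k.
Qed.

Let P (x : G) : {linear V -> V} := proj pi (slice x).

Let P_fixed x v : subgroup_set L x -> P x v = v <->
  forall k, subgroup_set K k -> pi [~ k, x]%g v = v.
Proof.
move=> Lx; split=> [<- k Kk|h]; last exact/proj_id/slice_fixedP.
by have /slice_fixedP := @proj_fixed _ _ _ pi (slice x) v; exact.
Qed.

Let M_comm m : subgroup_set M m -> commutes_with pi M (pi m).
Proof.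
by move=> Mm m' Mm' v; rewrite (rep_commute (commutator_sub Mm)).
Qed.

Let P_pi x m v : subgroup_set L x -> subgroup_set M m -> P x (pi m v) = pi m (P x v).
Proof.
move=> Lx Mm; apply: proj_rep => d Dd w Dw.
  by rewrite (M_comm (slice_sub Lx Dd)) // Dw.
have MV : subgroup_set M m^-1%g by exact: (@subgroupV _ M).
by rewrite (M_comm (slice_sub Lx Dd)) // Dw.
Qed.

Let PL (l : subgroup_type L) : {linear V -> V} := P (l : G).

Let subgroup_typeP (l : subgroup_type L) : subgroup_set L (l : G).
Proof. by have /asboolP := valP l. Qed.

(** Each slice projection moves [v] by at most r in squared norm, and the random subproduct argument
    gives 2r for any finite product of them. An element of [M] fixes the range of such a product,
    which costs a further factor 4. *)
Lemma near_fixed_commutator v r :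
  (forall k l, subgroup_set K k -> subgroup_set L l ->
     hsq (pi [~ k, l]%g v - v) <= r) ->
  forall m, subgroup_set M m -> hsq (pi m v - v) <= 8 * r.
Proof.
move=> vr.
have PL_dot x (u w : V) : dot (PL x u) w = dot u (PL x w) by exact: proj_dot.
have PL_idem x (u : V) : PL x (PL x u) = PL x u by apply/proj_id/proj_fixed.
have PL_comm x y (u : V) : PL x (PL y u) = PL y (PL x u).
  apply/esym/proj_uniq.
    move=> d Dd; have Md := slice_sub (subgroup_typeP y) Dd.
    rewrite -(P_pi _ (subgroup_typeP x) Md).
    by rewrite (@proj_fixed _ _ _ pi (slice y) u d Dd).
  move=> w Dw; rewrite -(linearB (PL x)) PL_dot proj_orth // => d Dd.
  have Md := slice_sub (subgroup_typeP y) Dd.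
  by rewrite -(P_pi _ (subgroup_typeP x) Md) Dw.
have valM (l x : subgroup_type L) : ((l * x)%g : G) = ((l : G) * (x : G))%g by [].
have PL_mul (l x : subgroup_type L) (u : V) : PL l u = u -> PL (l * x)%g u = PL x u.
  move=> lu'; have lu := proj1 (P_fixed _ (subgroup_typeP l)) lu'.
  have Pl := subgroup_typeP l; have Px := subgroup_typeP x.
  apply: proj_uniq.
    apply/slice_fixedP => k Kk; rewrite valM slice_mul //.
    rewrite -(P_pi _ Px (commutator_mem Kk Pl)) lu //.
    by have /slice_fixedP := @proj_fixed _ _ _ pi (slice x) u; exact.
  move=> w /slice_fixedP Dw.
  have -> : u - PL x u = PL l (u - PL x u) by rewrite linearB PL_comm lu'.
  rewrite PL_dot proj_orth //; apply/slice_fixedP => k Kk.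
  have lw : pi [~ k, (l : G)]%g (PL l w) = PL l w.
    by have /slice_fixedP := @proj_fixed _ _ _ pi (slice l) w; exact.
  rewrite -[in LHS]lw -slice_mul // -valM -(P_pi _ Pl) ?Dw //.
  exact: (commutator_mem Kk (subgroup_typeP (l * x)%g)).
have PL_div (l x : subgroup_type L) (u : V) :
    PL x u = u -> PL (l * x)%g u = u -> PL l u = u.
  have Pl := subgroup_typeP l; have Px := subgroup_typeP x.
  move=> /(P_fixed _ Px) xu /(P_fixed _ (subgroup_typeP (l * x)%g)) lxu.
  apply/(P_fixed _ Pl) => k Kk; have := lxu k Kk; rewrite valM slice_mul //.
  by rewrite (M_comm (commutator_mem Kk Px) (commutator_mem Kk Pl)) xu.
have near (y : subgroup_type L) : hsq (v - PL y v) <= r.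
  rewrite hsqBC; apply: proj_near => d Dd.
  by have [k [Kk ->]] := slice_orbit (subgroup_typeP y) Dd; exact: vr.
have far s : hsq (v - projs PL s v) <= 2 * r.
  have := cube_avg_ge PL_dot PL_idem PL_comm PL_mul PL_div s 1%g v.
  have := @cube_avg_le _ _ _ (fun x y : subgroup_type L => x * y)%g PL (fun=> True) s 1%g v r.
  by move=> /(_ (fun _ _ _ _ => I) (fun _ _ => I) I (fun y _ => near y)); lra.
(* An element of [M] is a word in commutators and involves only finitely many [l]. *)
pose S0 := [set m | exists s : seq (subgroup_type L),
   forall w, (forall l, List.In l s -> PL l w = w) -> pi m w = w].
have S1 : S0 1%g by exists [::] => w _; rewrite rep1.
have SM a b : S0 a -> S0 b -> S0 (a * b)%g.
  move=> [s sa] [t tb]; exists (s ++ t) => w hw.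
  rewrite rep_mul tb ?sa // => l lt; apply: hw; apply/List.in_app_iff; by [left|right].
have SV a : S0 a -> S0 a^-1%g.
  by move=> [s sa]; exists s => w /sa hw; rewrite -[X in pi _ X]hw repK.
move=> m Mm; have [] : S0 m.
  move/(_ (Subgroup S1 SM SV)): Mm; apply => _ [k Kk [l Ll <-]].
  have Lp : subgroup_pred L l by exact/asboolP.
  exists [:: SubgroupType Lp] => w /(_ _ (or_introl erefl)).
  by move/(P_fixed _ Ll)=> /(_ _ Kk).
move=> s hs; set w := projs PL s v.
have mw : pi m w = w.
  by apply: hs => l ls; exact: (projs_fixed PL_idem PL_comm).
have -> : pi m v - v = pi m (v - w) + (w - v).
  by rewrite linearB mw addrA subrK.
apply: le_trans (hsqD_le _ _) _; rewrite rep_hsq (hsqBC w).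
have := far s; rewrite -/w; lra.
Qed.

End CommutatorStep.

(** T(M) is used twice: on the relative kernel, to make [v] nearly fixed by [M], and then in
    [invariant_vector_of_near]. *)
Theorem kazhdan_commutator_step (R : realType) (G : groupType) (K L N : normalSubgroup G) :
  (forall x, subgroup_set L x -> subgroup_set K x) ->
  (forall k m, subgroup_set K k -> subgroup_set (commutator K L) m ->
     subgroup_set N [~ k, m]%g) ->
  kazhdan_mod R (commutator K L) -> kazhdan_mod R N.
Proof.
move=> LK KMN TM V pi piN AI; set M := commutator K L in KMN TM *.
have M_comm m : subgroup_set M m -> commutes_with pi M (pi m).
  by move=> Mm m' Mm' v; rewrite (rep_commute KMN piN (commutator_sub Mm)).
have K_comm k : subgroup_set K k -> commutes_with pi M (pi k).
  by move=> Kk m' Mm' v; rewrite (rep_commute KMN piN Kk).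
(* Commutators move [v] by at most 32d in squared norm and elements of [M] by 8 times that; 8/32 is
   the tolerance 1/4 of [invariant_vector_of_near]. *)
have [d [d0 dE]] : exists d : R, 0 < d /\ 32 * d = 32^-1.
  by exists (32^-1 / 32); split; [rewrite divr_gt0|rewrite mulrC divfK].
have [C1 [e1 [e10 HC]]] := kernels_uniform d0 (@subgroupV _ M) (@normalJ _ M) TM.
apply: (invariant_vector_of_near TM) => C e e0.
pose r := Num.min 1 (Num.min e e1).
have r0 : 0 < r by rewrite !lt_min ltr01 e0 e10.
have [v [vsq vr]] := near_unit_vectors AI (C ++ C1) r0.
exists v; split=> //.
  move=> s sC; apply: lt_le_trans (vr s _) _; first by rewrite mem_cat sC.
  by rewrite !ge_min lexx orbT.
have near g : 1 - relative_kernel pi M (pi g v) v <= d.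
  have := HC _ (relative_unit_kernel M_comm vsq) _ g; rewrite /= rep1; apply.
  move=> s sC; apply: le_lt_trans (relative_lower pi M s vsq) _.
  apply: lt_le_trans (vr s _) _; first by rewrite mem_cat sC orbT.
  by rewrite !ge_min lexx !orbT.
move=> m Mm; apply: le_trans (near_fixed_commutator LK KMN piN _ Mm) _; last first.
  by instantiate (1 := 32 * d); rewrite dE; lra.
move=> k l Kk Ll.
have Kl := LK _ Ll.
have := relative_commutator M_comm vsq (K_comm _ Kk) (K_comm _ Kl) d0.
(* As kl = lk[k, l], unitarity strips [l] and [k] from the difference. *)
rewrite commgC !rep_mul -linearB rep_hsq -linearB rep_hsq; apply.
  by have := near k; lra.
by have := near l; lra.
Qed.

(** * Quotients with finite-by-nilpotent images *)

Section QuotientRepresentations.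
Variables (R : realType) (G : groupType).

Lemma rep_coset (N : normalSubgroup G) (V : hilbertSpace R) (pi : unitaryRep G V) :
  (forall n, subgroup_set N n -> forall v, pi n v = v) ->
  forall x y, quotient_proj N x = quotient_proj N y -> forall v, pi x v = pi y v.
Proof.
move=> piN x y /quotient_projP xy v.
have -> : y = (x * (x^-1 * y))%g by rewrite mulgA mulgV mul1g.
by rewrite rep_mul (piN _ xy).
Qed.

Lemma property_T_quotientP (N : normalSubgroup G) :
  property_T R (quotient_group G N) <-> kazhdan_mod R N.
Proof.
split=> [T V pi piN AI|T V sigma AI].
- have cos := rep_coset piN.
  have projK q : quotient_proj N (repr q) = q by rewrite /quotient_proj reprK.
  have opM (p q : quotient_group G N) (v : V) :
      pi (repr (p * q)%g) v = pi (repr p) (pi (repr q) v).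
    by rewrite -rep_mul; apply: cos; rewrite projK.
  have opU q : unitary_operator (pi (repr (q : quotient_group G N))).
    exact: rep_unitary.
  have [|v [v0 hv]] := T V (UnitaryRep opU opM).
    move=> C e fC e0.
    have [v [v1 vC]] := AI (repr @` C) e (finite_image _ fC) e0.
    by exists v; split=> // q Cq; apply: vC; exists q.
  exists v; split=> // g; rewrite -[RHS](hv (quotient_proj N g)) /=.
  by apply: cos; rewrite projK.
- have opM (x y : G) (v : V) :
      sigma (quotient_proj N (x * y)%g) v = sigma (quotient_proj N x) (sigma (quotient_proj N y) v).
    by rewrite gmulfM rep_mul.
  have opU x : unitary_operator (sigma (quotient_proj N x)) by exact: rep_unitary.
  have [||v [v0 hv]] := T V (UnitaryRep opU opM).
  + move=> n Nn v /=.
    have p1 : quotient_proj N 1%g = 1%g by exact: gmulf1.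
    have <- : quotient_proj N 1%g = quotient_proj N n.
      by apply/quotient_projP; rewrite invg1 mul1g.
    by rewrite p1 rep1.
  + move=> C e fC e0.
    have [v [v1 vC]] := AI (quotient_proj N @` C) e (finite_image _ fC) e0.
    by exists v; split=> // x Cx; apply: vC; exists x.
  exists v; split=> // q; have [x ->] := quotient_proj_surj q; exact: hv.
Qed.

Lemma kazhdan_mod_sub (N N' : normalSubgroup G) :
  (forall x, subgroup_set N x -> subgroup_set N' x) ->
  kazhdan_mod R N -> kazhdan_mod R N'.
Proof. by move=> NN' T V pi piN'; apply: T => n /NN'; exact: piN'. Qed.

(** [M] acts through finitely many operators, so a vector almost invariant under representatives of
    its image is within the tolerance 1/4 on all of [M]. *)
Lemma kazhdan_mod_finite (M N : normalSubgroup G) :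
  finite_set (quotient_proj N @` (M : set G)) ->
  kazhdan_mod R M -> kazhdan_mod R N.
Proof.
move=> /finite_seqP[S MS] TM V pi piN AI; apply: (invariant_vector_of_near TM) => C e e0.
have r0 : 0 < Num.min e 4^-1 by rewrite lt_min e0 invr_gt0 ltr0n.
have [v [v1 vC]] := near_unit_vectors AI (C ++ map repr S) r0; exists v; split=> //.
  move=> s sC; apply: lt_le_trans (vC s _) _; first by rewrite mem_cat sC.
  by rewrite ge_min lexx.
move=> m Mm.
have mS : quotient_proj N m \in S.
  have : (quotient_proj N @` (M : set G)) (quotient_proj N m) by exists m.
  by rewrite MS.
have -> : pi m v = pi (repr (quotient_proj N m)) v.
  by apply: (rep_coset piN); rewrite /quotient_proj reprK.
apply/ltW/(lt_le_trans (vC _ _)); last by rewrite ge_min lexx orbT.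
by rewrite mem_cat map_f ?orbT.
Qed.

Variable K : normalSubgroup G.

Lemma lower_central_seriesS j : lower_central_series K j.+2 =
  commutator K (lower_central_series K j.+1).
Proof. by []. Qed.

Lemma lower_central_series_sub i j x : (i <= j)%N ->
  subgroup_set (lower_central_series K j.+1) x ->
  subgroup_set (lower_central_series K i.+1) x.
Proof.
move=> /subnK <-; elim: (j - i)%N => [//|n IH] h; apply: IH; move: h.
rewrite addSn lower_central_seriesS; apply => _ [k Kk [l Ll <-]].
rewrite commgEr; apply: subgroupM => //; apply: normalJ; exact: subgroupV.
Qed.

Lemma kazhdan_lower_central_series j : kazhdan_mod R (commutator K K) ->
  kazhdan_mod R (lower_central_series K j.+1).
Proof.
case: j => [|j] T.
  apply: kazhdan_mod_sub T => x; exact: (@lower_central_series_sub 0 1).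
(* The induction starts at [K, K], of index 2; the step takes L of index j + 1, M = [K, L] of index
   j + 2 and N = [K, M]. *)
elim: j => [//|j IH]; rewrite lower_central_seriesS.
apply: (kazhdan_commutator_step _ _ IH).
  by move=> x; exact: (@lower_central_series_sub 0 j).
by move=> k m Kk Mm; exact: commutator_mem.
Qed.

(** A multiplicative relation replaces a homomorphism from [K]: in the applications it relates
    elements of [G] to lifts in the subgroup type of the image, so no map into that type has to be
    built. *)
Lemma lower_central_series_rel (H : groupType) (r : G -> H -> Prop) :
  r 1%g 1%g -> (forall x y a b, r x a -> r y b -> r (x * y)%g (a * b)%g) ->
  (forall x a, r x a -> r x^-1%g a^-1%g) ->
  (forall x, subgroup_set K x -> exists a, r x a) ->
  forall j x, subgroup_set (lower_central_series K j.+1) x ->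
  exists a, subgroup_set (lower_central_series (full_normal H) j.+1) a /\ r x a.
Proof.
move=> r1 rM rV rK; elim=> [|j IH] x.
  by move=> /rK[a ra]; exists a.
pose S0 := [set x | exists a,
  subgroup_set (lower_central_series (full_normal H) j.+2) a /\ r x a].
have S1 : S0 1%g by exists 1%g; split=> //; exact: subgroup1.
have SM u v : S0 u -> S0 v -> S0 (u * v)%g.
  move=> [a [Ha ra]] [b [Hb rb]]; exists (a * b)%g; split; last exact: rM.
  exact: subgroupM.
have SV u : S0 u -> S0 u^-1%g.
  by move=> [a [Ha ra]]; exists a^-1%g; split; [exact: subgroupV|exact: rV].
rewrite lower_central_seriesS => /(_ (Subgroup S1 SM SV)); apply.
move=> _ [k Kk [l Ll <-]].
have [a ra] := rK k Kk; have [b [Hb rb]] := IH l Ll.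
exists [~ a, b]%g; split.
  exact: commutator_mem.
rewrite !commgEl !conjgE.
by apply: (rM); [exact: rV|apply: (rM); [exact: rV|exact: rM]].
Qed.

End QuotientRepresentations.

(** * Lower central series of nilpotent and finite-by-nilpotent images *)

Section NilpotentImages.
Variables (R : realType) (G : groupType) (K N : normalSubgroup G).
Let Q : groupType := quotient_group G N.
Let KN : groupType := subgroup_type (quotient_image N K).

Let lift_of (x : G) (y : KN) : Prop :=
  @subgroup_val Q (quotient_image N K) y = quotient_proj N x.

Let lift1 : lift_of 1%g 1%g.
Proof. by rewrite /lift_of gmulf1. Qed.

Let liftM x y a b : lift_of x a -> lift_of y b -> lift_of (x * y)%g (a * b)%g.
Proof.
have e : quotient_proj N (x * y)%g = (quotient_proj N x * quotient_proj N y)%g by exact: gmulfM.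
by rewrite /lift_of e => <- <-.
Qed.

Let liftV x a : lift_of x a -> lift_of x^-1%g a^-1%g.
Proof.
have e : quotient_proj N x^-1%g = (quotient_proj N x)^-1%g by exact: gmulfV.
by rewrite /lift_of e => <-.
Qed.

Let liftK x : subgroup_set K x -> exists a, lift_of x a.
Proof.
move=> Kx; have px : subgroup_pred (quotient_image N K) (quotient_proj N x).
  by apply/asboolP; exists x.
by exists (SubgroupType px).
Qed.

Lemma nilpotent_image_sub : nilpotent_group KN ->
  exists c, forall x, subgroup_set (lower_central_series K c.+1) x -> subgroup_set N x.
Proof.
move=> [c hc]; exists c => x hx.
have [a [ha la]] := lower_central_series_rel lift1 liftM liftV liftK hx.
have a1 : a = 1%g by move: ha; rewrite hc.
have : quotient_proj N 1%g = quotient_proj N x by rewrite -la a1 gmulf1.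
by move/quotient_projP; rewrite invg1 mul1g.
Qed.

Lemma finite_by_nilpotent_image : finite_by_nilpotent KN ->
  exists c, finite_set (quotient_proj N @` (lower_central_series K c.+1 : set G)).
Proof.
move=> [F [fF [c hc]]]; exists c.
apply: (@sub_finite_set _ _ (@subgroup_val Q (quotient_image N K) @` F)); last exact: finite_image.
move=> _ [x hx <-].
(* Lifting composed with the quotient by [F]: a relation to 1 places the lift in [F], which bounds
   the image of the series term by a finite set. *)
pose r x (h : quotient_group KN F) := exists y, lift_of x y /\ quotient_proj F y = h.
have [||||a [ha [y [ly ya]]]] := @lower_central_series_rel G K _ r _ _ _ _ c x hx.
- by exists 1%g; split; [exact: lift1|exact: gmulf1].
- move=> u v a b [y [ly <-]] [z [lz <-]]; exists (y * z)%g; split.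
    exact: liftM.
  exact: gmulfM.
- move=> u a [y [ly <-]]; exists y^-1%g; split; first exact: liftV.
  exact: gmulfV.
- by move=> u /liftK[y ly]; exists (quotient_proj F y), y.
exists y; last exact: ly.
have a1 : a = 1%g by move: ha; rewrite hc.
have : quotient_proj F 1%g = quotient_proj F y by rewrite ya a1 gmulf1.
by move/quotient_projP; rewrite invg1 mul1g.
Qed.

End NilpotentImages.

Theorem theorem2p6 (R : realType) (G : groupType) (K : normalSubgroup G)
    (c : nat) (countableG : countable [set: G]) (c_ge1 : (1 <= c)%N) :
  (property_T R (quotient_group G (lower_central_series K c.+1)) <->
   property_T R (quotient_group G (commutator K K)))
  /\
  (property_T R (quotient_group G (lower_central_series K c.+1)) /\
   property_T R (quotient_group G (commutator K K)) ->
   (forall N : normalSubgroup G,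
      nilpotent_group (subgroup_type (quotient_image N K)) ->
      property_T R (quotient_group G N))
   /\
   (forall N : normalSubgroup G,
      finite_by_nilpotent (subgroup_type (quotient_image N K)) ->
      property_T R (quotient_group G N))).
Proof.
split; [split=> /property_T_quotientP T|move=> [_ /property_T_quotientP T]; split=> N].
- apply/property_T_quotientP; apply: kazhdan_mod_sub T => x.
  (* Since 1 <= c, the term of index c + 1 lies in the term of index 2, which is [K, K]. *)
  exact: (@lower_central_series_sub _ _ 1 c).
- exact/property_T_quotientP/kazhdan_lower_central_series.
- move=> nilN; have [d dN] := nilpotent_image_sub nilN; apply/property_T_quotientP.
  by apply: (kazhdan_mod_sub dN); exact: kazhdan_lower_central_series.
- move=> finN; have [d dN] := finite_by_nilpotent_image finN; apply/property_T_quotientP.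
  by apply: (kazhdan_mod_finite dN); exact: kazhdan_lower_central_series.
Qed.
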